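(* Let $\mathcal E$ be a finite dimensional Hilbert space, $n\ge2$, and let $(\psi_1,\dots,\psi_n)$ be a factorizing tuple. Then there is a unique pair $(\underline A,\underline B)$, where $\underline A=(A_1,\dots,A_n)$ is a tuple of self-adjoint operators and $\underline B=(B_1,\dots,B_n)$ a tuple of positive contractions on $\mathcal E$, satisfying (1) $A_jA_k=A_kA_j$ and $B_jB_k=B_kB_j$ for all $j,k$; (2) $A_jB_k+B_jA_k=A_kB_j+B_kA_j$ for all $j,k$; (3) $A_1+\cdots+A_n=0$ and $B_1+\cdots+B_n=I$; such that $(\psi_j(z)+I)(\psi_j(z)-I)^{-1}=iA_j+\zeta(z)B_j$ for all $z\in\mathbb D$ and $j=1,\dots,n$. Consequently $\psi_j(z)=(iA_j+\zeta(z)B_j+I)(iA_j+\zeta(z)B_j-I)^{-1}$ for all $z\in\mathbb D$ and all $j$.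
   Context: $\mathbb D$ is the open unit disc, $\zeta(z)=\frac{z+1}{z-1}$, $H^2_{\mathbb D}(\mathcal E)$ the $\mathcal E$-valued Hardy space, $M_\psi$ multiplication by $\psi$. $\mathcal C=\{\psi\in H^\infty_{\mathbb D}(\mathcal B(\mathcal E)):\sup_z\|\psi(z)\|\le1,\ 1\text{ is not an eigenvalue of }\psi(z)\text{ for any }z\in\mathbb D\}$. $\varphi_t(\lambda)=e^{t\frac{\lambda+1}{\lambda-1}}$, $(\varphi_t\circ\psi)(z)=\varphi_t(\psi(z))$, $\mathfrak z^{\mathcal E}(w)=wI_{\mathcal E}$. A tuple $(\psi_1,\dots,\psi_n)$ with $\psi_j\in\mathcal C$ is a factorizing tuple if $M_{\varphi_t\circ\psi_j}M_{\varphi_t\circ\psi_k}=M_{\varphi_t\circ\psi_k}M_{\varphi_t\circ\psi_j}$ for all $j,k$ and $t\ge0$, and $M_{\varphi_t\circ\psi_1}\cdots M_{\varphi_t\circ\psi_n}=M_{\varphi_t\circ\mathfrak z^{\mathcal E}}$ for all $t\ge0$. *)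

(* Defs.v *)
(* MathComp + MathComp-Analysis (classical layer) + real-closed complex numbers.
   The complex field is  R[i]  for  R : realType. The finite-dimensional Hilbert space
   E is C^d (column vectors 'cV[R[i]]_d with the standard inner product); operators on
   E are matrices 'M[R[i]]_d acting on column vectors by  A *m v. *)
From mathcomp Require Import all_boot all_order all_algebra.
From mathcomp Require Import complex.
From mathcomp Require Import all_classical all_reals.
Set Implicit Arguments. Unset Strict Implicit. Unset Printing Implicit Defensive.
Import Order.TTheory GRing.Theory Num.Theory.
Local Open Scope ring_scope.

Section Defs.
Variable R : realType.
Local Notation C := (R[i]).

(* convergence of a complex sequence (epsilon-N, with the modulus of R[i]) *)
Definition cconv (u : nat -> C) (l : C) : Prop :=
  forall e : C, 0 < e -> exists N : nat, forall n : nat, (N <= n)%N -> `|u n - l| < e.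

(* the open unit disc D *)
Definition in_disc (z : C) : Prop := `|z| < 1.

(* squared Hilbert norm on E = C^d *)
Definition vnorm2 (d : nat) (v : 'cV[C]_d) : C := \sum_(i < d) `|v i 0| ^+ 2.

(* Hilbert-space adjoint (conjugate transpose) *)
Definition mxadj (m n : nat) (A : 'M[C]_(m, n)) : 'M[C]_(n, m) :=
  (map_mx (fun z : C => z^*) A)^T.

Definition selfadjoint (d : nat) (A : 'M[C]_d) : Prop := mxadj A = A.

(* contraction: operator norm <= 1 *)
Definition contraction (d : nat) (A : 'M[C]_d) : Prop :=
  forall v : 'cV[C]_d, vnorm2 (A *m v) <= vnorm2 v.

(* positive operator: <A v, v> >= 0 for all v *)
Definition positive_op (d : nat) (A : 'M[C]_d) : Prop :=
  forall v : 'cV[C]_d, 0 <= (mxadj v *m A *m v) 0 0.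

(* holomorphic on D (given by a power series converging on D, entrywise) *)
Definition analytic_disc (m n : nat) (f : C -> 'M[C]_(m, n)) : Prop :=
  exists c : nat -> 'M[C]_(m, n), forall z : C, in_disc z ->
    forall i j, cconv (fun N => \sum_(k < N) c k i j * z ^+ k) (f z i j).

(* the class  C  of the paper: H^infty(B(E)) functions with sup-norm <= 1
   such that 1 is not an eigenvalue of psi(z) for any z in D *)
Definition classC (d : nat) (psi : C -> 'M[C]_d) : Prop :=
  [/\ analytic_disc psi,
      (forall z, in_disc z -> contraction (psi z)) &
      (forall z, in_disc z -> forall v : 'cV[C]_d, psi z *m v = v -> v = 0)].

(* the Hardy space H^2_D(E): f(z) = sum_k c_k z^k on D with sum_k ||c_k||^2 < oo *)
Definition inH2 (d : nat) (f : C -> 'cV[C]_d) : Prop :=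
  exists c : nat -> 'cV[C]_d,
    (exists B : C, forall N : nat, \sum_(k < N) vnorm2 (c k) <= B) /\
    (forall z : C, in_disc z ->
       forall i, cconv (fun N => \sum_(k < N) c k i 0 * z ^+ k) (f z i 0)).

(* operators on H^2 are represented as maps on E-valued functions on D *)
Definition H2op (d : nat) := (C -> 'cV[C]_d) -> (C -> 'cV[C]_d).

(* multiplication operator M_psi *)
Definition Mop (d : nat) (psi : C -> 'M[C]_d) : H2op d :=
  fun f z => psi z *m f z.

(* equality of operators on H^2_D(E) (elements of H^2 are functions on D) *)
Definition opeqH2 (d : nat) (T S : H2op d) : Prop :=
  forall f, inH2 f -> forall z, in_disc z -> T f z = S f z.

(* matrix exponential, as the (unique) limit of the exponential series *)
Definition is_mexp (d : nat) (M E : 'M[C]_d) : Prop :=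
  forall i j, cconv (fun N => (\sum_(k < N) (k`!%:R)^-1 *: M ^+ k) i j) (E i j).

Definition mexp (d : nat) (M : 'M[C]_d) : 'M[C]_d :=
  xget 0 [set E | is_mexp M E].

(* Cayley transform  (M + I)(M - I)^{-1} *)
Definition cayley (d : nat) (M : 'M[C]_d) : 'M[C]_d :=
  (M + 1%:M) *m invmx (M - 1%:M).

(* zeta(z) = (z+1)/(z-1) *)
Definition zeta (z : C) : C := (z + 1) / (z - 1).

(* phi_t(lambda) = exp(t (lambda+1)/(lambda-1)), applied to an operator by the
   (holomorphic) functional calculus *)
Definition phi_op (t : R) (d : nat) (M : 'M[C]_d) : 'M[C]_d :=
  mexp (real_complex R t *: cayley M).

(* phi_t o psi *)
Definition phicomp (t : R) (d : nat) (psi : C -> 'M[C]_d) : C -> 'M[C]_d :=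
  fun z => phi_op t (psi z).

(* z^E(w) = w I_E *)
Definition zmat (d : nat) : C -> 'M[C]_d := fun w => w *: 1%:M.

(* product of operators M_{phi_t o psi_1} ... M_{phi_t o psi_n} (psi_n applied first) *)
Definition prodMop (t : R) (n d : nat) (psi : 'I_n -> C -> 'M[C]_d) : H2op d :=
  foldr (fun j (acc : H2op d) => fun f => Mop (phicomp t (psi j)) (acc f))
        (fun f => f) (enum 'I_n).

Definition factorizing (n d : nat) (psi : 'I_n -> C -> 'M[C]_d) : Prop :=
  [/\ (forall j, classC (psi j)),
      (forall (j k : 'I_n) (t : R), 0 <= t ->
         opeqH2 (fun f => Mop (phicomp t (psi j)) (Mop (phicomp t (psi k)) f))
                (fun f => Mop (phicomp t (psi k)) (Mop (phicomp t (psi j)) f))) &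
      (forall t : R, 0 <= t ->
         opeqH2 (prodMop t psi) (Mop (phicomp t (@zmat d))))].

(* the conditions on the pair (A, B) in Theorem 4.9 *)
Definition good_pair (n d : nat) (psi : 'I_n -> C -> 'M[C]_d)
    (A B : 'I_n -> 'M[C]_d) : Prop :=
  [/\ (forall j, selfadjoint (A j) /\ (positive_op (B j) /\ contraction (B j))),
      (forall j k, A j *m A k = A k *m A j /\ B j *m B k = B k *m B j),
      (forall j k, A j *m B k + B j *m A k = A k *m B j + B k *m A j),
      (\sum_(j < n) A j = 0 /\ \sum_(j < n) B j = 1%:M) &
      (forall j z, in_disc z ->
         cayley (psi j z) = 'i *: A j + zeta z *: B j)].

End Defs.

(* Main.v *)
Require Import Defs.
From mathcomp Require Import all_boot all_order all_algebra.
From mathcomp Require Import all_solvable all_field ring.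
From mathcomp Require Import complex.
From mathcomp Require Import all_classical all_reals.
Import Order.TTheory GRing.Theory Num.Theory.
Local Open Scope ring_scope.

(** Differentiating [phi_t o psi_j = exp (t G_j)] at [t = 0], where [G_j] is the
    Cayley transform of [psi_j], shows that the values [G_j(z)] commute and that
    [sum_j G_j(z) = zeta(z) I].  Write [T'] for the adjoint of [T].  The
    Schwarz--Pick inequality for [psi_j] at the points [0] and [z] says that
    [- (G_j(p) + G_j(q)') / (1 - p q')] is a positive kernel on [{0, z}].  These
    kernels sum over [j] to the rank-one kernel [2 / ((1 - p) (1 - q'))] of [- zeta].
    Hence a vector in the kernel of the sum is in the kernel of each summand, which
    expresses [G_j(z)] through [G_j(0)] as [i A_j + zeta(z) B_j] with
    [B_j = - Re G_j(0)] and [A_j = Im G_j(0)].  The algebraic relations follow by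
    comparing coefficients of the powers of [zeta].  The Schwarz--Pick inequality
    itself is obtained from polynomial approximants of [psi_j (r .)] and Parseval's
    identity on roots of unity. *)

(** * Adjoints and the inner product *)

Section Adjoint.
Set Implicit Arguments.
Unset Strict Implicit.
Variable R : realType.
Local Notation C := R[i].

Lemma mxadjE m n (M : 'M[C]_(m, n)) i j : mxadj M i j = (M j i)^*.
Proof. by rewrite !mxE. Qed.

Lemma mxadjK m n (M : 'M[C]_(m, n)) : mxadj (mxadj M) = M.
Proof. by apply/matrixP => i j; rewrite !mxadjE conjCK. Qed.

Lemma mxadjM m n p (M : 'M[C]_(m, n)) (N : 'M[C]_(n, p)) :
  mxadj (M *m N) = mxadj N *m mxadj M.
Proof.
apply/matrixP => i j; rewrite mxadjE !mxE rmorph_sum /=.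
by apply: eq_bigr => k _; rewrite !mxadjE rmorphM mulrC.
Qed.

Lemma mxadjD m n (M N : 'M[C]_(m, n)) : mxadj (M + N) = mxadj M + mxadj N.
Proof. by apply/matrixP => i j; rewrite !mxE rmorphD. Qed.

Lemma mxadjN m n (M : 'M[C]_(m, n)) : mxadj (- M) = - mxadj M.
Proof. by apply/matrixP => i j; rewrite !mxE rmorphN. Qed.

Lemma mxadjZ m n a (M : 'M[C]_(m, n)) : mxadj (a *: M) = a^* *: mxadj M.
Proof. by apply/matrixP => i j; rewrite !mxE rmorphM. Qed.

Lemma mxadj1 n : mxadj (1%:M : 'M[C]_n) = 1%:M.
Proof. by apply/matrixP => i j; rewrite !mxE eq_sym rmorph_nat. Qed.

Definition dot {d : nat} (u v : 'cV[C]_d) : C := (mxadj u *m v) 0 0.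

Variable d : nat.
Implicit Types (u v w : 'cV[C]_d) (M : 'M[C]_d).

Lemma dotE u v : dot u v = \sum_i (u i 0)^* * v i 0.
Proof. by rewrite /dot !mxE; apply: eq_bigr => i _; rewrite mxadjE. Qed.

Lemma dotC u v : dot v u = (dot u v)^*.
Proof.
rewrite !dotE rmorph_sum; apply: eq_bigr => i _.
by rewrite rmorphM /= conjCK mulrC.
Qed.

Lemma dotDr u v w : dot u (v + w) = dot u v + dot u w.
Proof. by rewrite /dot mulmxDr mxE. Qed.

Lemma dotDl u v w : dot (u + v) w = dot u w + dot v w.
Proof. by rewrite /dot mxadjD mulmxDl mxE. Qed.

Lemma dotZr a u v : dot u (a *: v) = a * dot u v.
Proof. by rewrite /dot -scalemxAr mxE. Qed.

Lemma dotZl a u v : dot (a *: u) v = a^* * dot u v.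
Proof. by rewrite /dot mxadjZ -scalemxAl mxE. Qed.

Lemma dotNr u v : dot u (- v) = - dot u v.
Proof. by rewrite /dot mulmxN mxE. Qed.

Lemma dotNl u v : dot (- u) v = - dot u v.
Proof. by rewrite /dot mxadjN mulNmx mxE. Qed.

Lemma dot0r u : dot u 0 = 0.
Proof. by rewrite /dot mulmx0 mxE. Qed.

Lemma dot_sumr I (r : seq I) (P : pred I) (F : I -> 'cV[C]_d) u :
  dot u (\sum_(i <- r | P i) F i) = \sum_(i <- r | P i) dot u (F i).
Proof. exact: (big_morph _ (dotDr u) (dot0r u)). Qed.

Lemma dot_adjl M u v : dot (M *m u) v = dot u (mxadj M *m v).
Proof. by rewrite /dot mxadjM mulmxA. Qed.

Lemma dot_adjr M u v : dot u (M *m v) = dot (mxadj M *m u) v.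
Proof. by rewrite dot_adjl mxadjK. Qed.

Lemma vnorm2_dot u : vnorm2 u = dot u u.
Proof. by rewrite dotE; apply: eq_bigr => i _; rewrite normCKC. Qed.

Lemma dot_ge0 u : 0 <= dot u u.
Proof. by rewrite -vnorm2_dot sumr_ge0 // => i _; rewrite exprn_ge0. Qed.

Lemma dot_eq0 u : dot u u = 0 -> u = 0.
Proof.
rewrite -vnorm2_dot => /eqP; rewrite psumr_eq0; last first.
  by move=> i _; rewrite exprn_ge0.
move=> /allP u0; apply/colP => i; rewrite mxE; apply/eqP.
have /implyP/(_ isT) := u0 i (mem_index_enum _).
by rewrite expf_eq0 normr_eq0.
Qed.

End Adjoint.

(** * Parseval's identity on roots of unity *)

Section Parseval.
Set Implicit Arguments.
Unset Strict Implicit.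
Variable F : numClosedFieldType.
Implicit Types (q : {poly F}) (x y w z : F).

(** In characteristic 0 the polynomial ['X^n - 1] is separable, so it has [n] distinct roots, and a
    finite group of roots of unity is cyclic. *)
Lemma closed_prim_root_exists n : (0 < n)%N -> exists w : F, n.-primitive_root w.
Proof.
move=> n_gt0; have [rs def_p] := closed_field_poly_normal ('X^n - 1 : {poly F}).
have lead1 : lead_coef ('X^n - 1 : {poly F}) = 1 by exact: lead_coefXnsubC.
rewrite lead1 scale1r in def_p.
have sz_rs : size rs = n.
  by apply: succn_inj; rewrite -(size_prod_XsubC rs id) -def_p -polyC1 size_XnsubC.
have all_rs : all n.-unity_root rs.
  by apply/allP=> t; rewrite -root_prod_XsubC -def_p.
have uniq_rs : uniq rs.
  by rewrite -separable_prod_XsubC -def_p separable_Xn_sub_1 // pnatr_eq0 -lt0n.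
have /hasP[w _ ?] := cyclic.has_prim_root n_gt0 all_rs uniq_rs (eq_leq (esym sz_rs)).
by exists w.
Qed.

Lemma norm_prim_root n w : n.-primitive_root w -> `|w| = 1.
Proof.
move=> prim_w; apply/eqP; rewrite -(pexpr_eq1 (prim_order_gt0 prim_w) (normr_ge0 w)).
by rewrite -normrX prim_expr_order // normr1.
Qed.

(** This is a geometric sum with ratio [u], where [u ^+ n = 1] and [u = 1] only if [m = l]. *)
Lemma prim_root_orthogonal n w (m l : 'I_n) : n.-primitive_root w ->
  \sum_(j < n) (w ^+ j) ^+ m * ((w ^+ j) ^+ l)^* = n%:R *+ (m == l).
Proof.
move=> prim_w; have w1 := norm_prim_root prim_w.
have wC : w * w^* = 1 by rewrite -normCK w1 expr1n.
pose u := w ^+ m * (w ^+ l)^*.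
have eq_u (j : nat) : (w ^+ j) ^+ m * ((w ^+ j) ^+ l)^* = u ^+ j.
  by rewrite /u exprMn -!exprM !rmorphXn /= -exprM !(mulnC j).
under eq_bigr do rewrite eq_u.
case: eqP => [eq_ml|neq_ml].
  have -> : u = 1 by rewrite /u eq_ml rmorphXn /= -exprMn wC expr1n.
  by under eq_bigr do rewrite expr1n; rewrite sumr_const card_ord mulr1n.
rewrite mulr0n; apply: (@mulfI _ (u - 1)).
  rewrite subr_eq0; apply/eqP => u1; apply: neq_ml; apply/val_inj => /=.
  have /eqP : w ^+ m == w ^+ l.
    rewrite -[w ^+ m]mulr1 -(expr1n _ l) -wC exprMn mulrCA -rmorphXn.
    by rewrite [X in _ * X]u1 mulr1.
  by move/eqP; rewrite (eq_prim_root_expr prim_w) !modn_small // => /eqP.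
have wn (k : nat) : (w ^+ k) ^+ n = 1 by rewrite exprAC (prim_expr_order prim_w) expr1n.
by rewrite mulr0 -subrX1 /u exprMn -rmorphXn !wn /= conjC1 mulr1 subrr.
Qed.

(** Sampling at roots of unity replaces integration over the circle; it is exact because [q] has
    degree below [n]. *)
Lemma parseval n w q : n.-primitive_root w -> (size q <= n)%N ->
  \sum_(j < n) `|q.[w ^+ j]| ^+ 2 = n%:R * \sum_(m < n) `|q`_m| ^+ 2.
Proof.
move=> prim_w sz_q.
under eq_bigr => j _.
  rewrite normCK (horner_coef_wide _ sz_q) rmorph_sum mulr_suml.
  under eq_bigr => m _ do (rewrite mulr_sumr; under eq_bigr => l _ do
    rewrite rmorphM mulrACA).
  over.
rewrite exchange_big mulr_sumr; apply: eq_bigr => m _ /=.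
rewrite exchange_big /= (bigD1 m) //= [X in _ + X]big1 ?addr0 => [|l neq_lm].
  by rewrite -mulr_sumr (prim_root_orthogonal _ _ prim_w) eqxx mulr1n -normCK mulrC.
by rewrite -mulr_sumr (prim_root_orthogonal _ _ prim_w) eq_sym (negPf neq_lm) mulr0n mulr0.
Qed.

(** The combination [x k_0 + y k_z] of the Szego kernels at 0 and [z], with [k_z] cut to degree
    below [K] so as to be a polynomial. *)
Definition szego (K : nat) (z x y : F) : {poly F} :=
  x%:P + y *: \poly_(m < K) (z^* ^+ m).

Definition geom (K : nat) (t : F) : F := \sum_(m < K) t ^+ m.

Lemma size_szego K z x y : (0 < K)%N -> (size (szego K z x y) <= K)%N.
Proof.
move=> K_gt0; rewrite (leq_trans (size_polyD _ _)) // geq_max.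
rewrite (leq_trans (size_polyC_leq1 _)) //=.
by rewrite (leq_trans (size_scale_leq _ _)) // size_poly.
Qed.

Lemma szego0 K z x y : (0 < K)%N -> (szego K z x y).[0] = x + y.
Proof.
case: K => // K _; rewrite horner_coef0 /szego !coefE.
by rewrite expr0 mulr1.
Qed.

Lemma szegoE K z x y : (szego K z x y).[z] = x + y * geom K (z^* * z).
Proof.
rewrite /szego !hornerE horner_poly; congr (_ + _ * _).
by apply: eq_bigr => m _; rewrite -exprMn.
Qed.

(** Reproducing property of the kernels. The cut at [K] is harmless since [size q <= K], and summing
    up to [N] only adds zero terms. *)
Lemma sum_conj_szego K N z x y q : (0 < K <= N)%N -> (size q <= K)%N ->
  \sum_(m < N) ((szego K z x y)`_m)^* * q`_m = x^* * q.[0] + y^* * q.[z].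
Proof.
case/andP; case: K => // K _ leKN sz_q.
case: N leKN => // N leKN.
rewrite [q.[z]](horner_coef_wide _ (leq_trans sz_q leKN)) horner_coef0.
under eq_bigr => m _.
  rewrite !coefE rmorphD rmorphM /= mulrDl.
  over.
rewrite big_split /=; congr (_ + _).
  rewrite big_ord_recl /= big1 ?addr0 // => i _.
  by rewrite /= conjC0 mul0r.
rewrite mulr_sumr; apply: eq_bigr => m _.
case: ltnP => [ltmK|geKm].
  by rewrite rmorphXn /= conjCK; ring.
by rewrite (nth_default _ (leq_trans sz_q geKm)) !(mulr0, mul0r).
Qed.

Lemma sum_norm_szego K N z x y : (0 < K <= N)%N ->
  \sum_(m < N) `|(szego K z x y)`_m| ^+ 2 =
  x^* * x + (x^* * y + y^* * x) + geom K (z^* * z) * (y^* * y).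
Proof.
move=> KN; have K_gt0 : (0 < K)%N by case/andP: KN.
under eq_bigr do rewrite normCKC.
rewrite (sum_conj_szego _ _ _ KN) ?size_szego // szego0 // szegoE; ring.
Qed.

(* The coefficients of a Szego kernel reproduce values of [q] by [sum_conj_szego];
   expand [0 <= sum_m |h_m - q_m|^2]. *)
Lemma szego_pairing N z x y q : (0 < N)%N -> (size q <= N)%N ->
  x^* * q.[0] + y^* * q.[z] + (x^* * q.[0] + y^* * q.[z])^* <=
  x^* * x + (x^* * y + y^* * x) + geom N (z^* * z) * (y^* * y)
  + \sum_(m < N) `|q`_m| ^+ 2.
Proof.
move=> N_gt0 sz_q; have NN : (0 < N <= N)%N by rewrite N_gt0 /=.
rewrite -(sum_norm_szego _ _ _ NN) // -(sum_conj_szego _ _ _ NN) // rmorph_sum /=.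
rewrite -!big_split /=; apply: ler_sum => m _; set h := _`_m.
rewrite -subr_ge0 (_ : _ - _ = `|h - q`_m| ^+ 2) ?exprn_ge0 //.
by rewrite !normCKC !(rmorphB, rmorphM, rmorphD) /= !conjCK; ring.
Qed.

End Parseval.

(** * The Pick inequality for matrix polynomials bounded on the circle *)

Section PolyInequality.
Set Implicit Arguments.
Unset Strict Implicit.
Variable R : realType.
Local Notation C := R[i].
Variable d : nat.
Implicit Types (x y a b : 'cV[C]_d) (P : 'M[{poly C}]_d).

Definition eval_mx P (w : C) : 'M[C]_d := \matrix_(i, j) (P i j).[w].

Lemma mulmx_eval_mx P (g : 'cV[{poly C}]_d) w i :
  ((P *m g) i 0).[w] = (eval_mx P w *m \col_k (g k 0).[w]) i 0.
Proof.
rewrite !mxE horner_sum; apply: eq_bigr => j _.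
by rewrite hornerM !mxE.
Qed.

(** The squared norm of [x k_0 + y k_z] when [k_z] has squared norm [k]; the other Gram entries of
    the two kernels are 1. *)
Definition szego_form (k : C) x y := dot x x + (dot x y + dot y x) + k * dot y y.

Lemma szego_formE k x y : szego_form k x y =
  \sum_i ((x i 0)^* * x i 0 + ((x i 0)^* * y i 0 + (y i 0)^* * x i 0) +
    k * ((y i 0)^* * y i 0)).
Proof. by rewrite /szego_form !dotE !big_split mulr_sumr. Qed.

(** With [g] the kernel combination for [a, b], [h] the one for [x, y], and [f = P g], this is
    [2 Re <h, f> <= |h|^2 + |f|^2] together with [|f|^2 <= eta |g|^2]. The cut [K] of [g] is given
    beforehand, whereas the cut [N] of [h] must grow with the degree of [P]. *)
Lemma poly_pick P (K : nat) (z eta : C) x y a b : (0 < K)%N ->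
  (forall w v, `|w| = 1 -> vnorm2 (eval_mx P w *m v) <= eta * vnorm2 v) ->
  exists N : nat,
  let s := dot x (eval_mx P 0 *m (a + b)) +
           dot y (eval_mx P z *m (a + geom K (z^* * z) *: b)) in
  s + s^* <= szego_form (geom N (z^* * z)) x y
             + eta * szego_form (geom K (z^* * z)) a b.
Proof.
move=> K_gt0 contrP.
pose g : 'cV[{poly C}]_d := \col_i szego K z (a i 0) (b i 0).
pose f : 'cV[{poly C}]_d := P *m g.
(* Large enough for Parseval at the [N]-th roots of unity to apply to every entry of both [f] and
   [g]. *)
pose N := (K + \sum_i size (f i 0%R))%N.
have leKN : (K <= N)%N by rewrite leq_addr.
have N_gt0 : (0 < N)%N by rewrite (leq_trans K_gt0).
have sz_f i : (size (f i 0%R) <= N)%N.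
  by rewrite /N (bigD1 i) //= addnCA leq_addr.
have sz_g i : (size (g i 0%R) <= N)%N.
  by rewrite mxE (leq_trans _ leKN) // size_szego.
have [w prim_w] := closed_prim_root_exists C N_gt0.
have f0 i : (f i 0).[0] = (eval_mx P 0 *m (a + b)) i 0.
  rewrite mulmx_eval_mx; congr ((_ *m _) i 0); apply/colP => k.
  by rewrite !mxE szego0.
have fz i : (f i 0).[z] = (eval_mx P z *m (a + geom K (z^* * z) *: b)) i 0.
  rewrite mulmx_eval_mx; congr ((_ *m _) i 0); apply/colP => k.
  by rewrite !mxE szegoE mulrC.
have normg : \sum_i \sum_(m < N) `|(g i 0)`_m| ^+ 2 = szego_form (geom K (z^* * z)) a b.
  rewrite szego_formE; apply: eq_bigr => i _.
  by rewrite mxE sum_norm_szego ?K_gt0.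
exists N => /=.
have normf : \sum_i \sum_(m < N) `|(f i 0)`_m| ^+ 2 <=
             eta * szego_form (geom K (z^* * z)) a b.
  (* The factor [N] turns coefficient sums into sums over samples on the circle, where the bound on
     [P] holds pointwise. *)
  rewrite -normg -(@ler_pM2l _ N%:R) ?ltr0n // mulrCA !mulr_sumr.
  under eq_bigr do rewrite -(parseval prim_w) //.
  under [X in _ <= X]eq_bigr do rewrite -(parseval prim_w) //.
  rewrite -mulr_sumr exchange_big [X in _ <= _ * X]exchange_big mulr_sumr /=.
  apply: ler_sum => j _.
  have w1 : `|w ^+ j| = 1 by rewrite normrX (norm_prim_root prim_w) expr1n.
  have := contrP (w ^+ j) (\col_k (g k 0).[w ^+ j]) w1.
  have -> : vnorm2 (eval_mx P (w ^+ j) *m \col_k (g k 0).[w ^+ j]) =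
            \sum_i `|(f i 0).[w ^+ j]| ^+ 2.
    by apply: eq_bigr => i _; rewrite mulmx_eval_mx.
  have -> // : vnorm2 (\col_k (g k 0).[w ^+ j]) = \sum_i `|(g i 0).[w ^+ j]| ^+ 2.
  by apply: eq_bigr => i _; rewrite [in LHS]mxE.
apply: (le_trans _ (lerD (lexx _) normf)).
rewrite szego_formE -big_split !dotE rmorphD !rmorph_sum -!big_split /=.
apply: ler_sum => i _.
have := szego_pairing z (x i 0) (y i 0) N_gt0 (sz_f i).
by rewrite -f0 -fz rmorphD.
Qed.

End PolyInequality.

(** * Polynomial approximation of power series *)

Section Geometric.
Set Implicit Arguments.
Unset Strict Implicit.
Variable R : realType.
Local Notation C := R[i].

Lemma complex_archi (x : C) : 0 <= x -> exists n : nat, x <= n%:R.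
Proof.
rewrite lecE /= => /andP[/eqP im0 re0]; exists (Num.bound (complex.Re x)).
have -> : x = (real_complex R (complex.Re x)) by case: x im0 {re0} => a b /= ->.
by rewrite -(rmorph_nat (real_complex R)) lecE /= eqxx ltW // archi_boundP.
Qed.

Lemma bernoulli_le (h : C) n : 0 <= h -> h *+ n <= (1 + h) ^+ n.
Proof.
move=> h0; suff : 1 + h *+ n <= (1 + h) ^+ n by apply: le_trans; rewrite lerDr.
elim: n => [|n IHn]; first by rewrite mulr0n addr0 expr0.
rewrite exprS; have h1 : 0 <= 1 + h by rewrite addr_ge0.
apply: le_trans (ler_wpM2l h1 IHn).
rewrite -subr_ge0 mulrS (_ : _ - _ = h * (h *+ n)); last by ring.
by rewrite mulr_ge0 // mulrn_wge0.
Qed.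

Lemma exists_expr_le (q e : C) : 0 <= q -> q < 1 -> 0 < e -> exists n : nat, q ^+ n <= e.
Proof.
rewrite le_eqVlt => /orP[/eqP<- _ e0|q0 q1 e0]; first by exists 1%N; rewrite expr1 ltW.
pose h := q^-1 - 1; have h0 : 0 < h by rewrite subr_gt0 invf_gt1.
have e0' : 0 < e^-1 by rewrite invr_gt0.
have [n len] := complex_archi (ltW (divr_gt0 e0' h0)).
exists n; rewrite -[q]invrK exprVn -[e]invrK lef_pV2 ?posrE ?exprn_gt0 ?invr_gt0 //.
have := bernoulli_le n (ltW h0); rewrite [1 + h]addrC {2}/h subrK.
apply: le_trans.
by rewrite -[h *+ n]mulr_natl -ler_pdivrMr.
Qed.

Lemma geom_lim (q : C) n : q != 1 -> (1 - q)^-1 = geom n q + (1 - q)^-1 * q ^+ n.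
Proof.
move=> q1; have q1' : 1 - q != 0 by rewrite subr_eq0 eq_sym.
apply: (mulfI q1'); rewrite mulrDr mulrA divff // mul1r /geom.
by rewrite -opprB mulNr -subrX1 opprB subrK.
Qed.

Lemma geom_ge0 (q : C) n : 0 <= q -> 0 <= geom n q.
Proof. by move=> q0; apply: sumr_ge0 => i _; rewrite exprn_ge0. Qed.

Lemma geom_le (q : C) n : 0 <= q -> q < 1 -> geom n q <= (1 - q)^-1.
Proof.
move=> q0 q1; rewrite (geom_lim n (negbT (lt_eqF q1))) lerDl mulr_ge0 ?exprn_ge0 //.
by rewrite invr_ge0 subr_ge0 ltW.
Qed.

Lemma exists_geom_ge (q e : C) : 0 <= q -> q < 1 -> 0 < e ->
  exists2 n, (0 < n)%N & (1 - q)^-1 <= geom n q + e.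
Proof.
move=> q0 q1 e0; have k0 : 0 < 1 - q by rewrite subr_gt0.
have [n le_n] := exists_expr_le q0 q1 (mulr_gt0 k0 e0).
exists n.+1 => //; rewrite (geom_lim n.+1 (negbT (lt_eqF q1))) lerD2l.
rewrite ler_pdivrMl // (le_trans _ le_n) // exprS ler_piMl ?exprn_ge0 //.
exact: ltW.
Qed.

(** A late term is the difference of two partial sums within 1 of the limit, hence at most 2 in
    modulus; the finitely many early ones are bounded by their sum [S]. *)
Lemma cconv_terms_bounded (u : nat -> C) l :
  cconv (fun n => \sum_(k < n) u k) l -> exists2 M, 0 < M & forall k, `|u k| <= M.
Proof.
move=> /(_ 1 ltr01)[N HN]; pose S := \sum_(k < N) `|u k|.
have S0 : 0 <= S by apply: sumr_ge0 => i _.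
exists (2 + S) => [|k]; first by rewrite ltr_wpDr.
case: (ltnP k N) => [ltkN|leNk].
  rewrite /S (bigD1 (Ordinal ltkN)) //= addrCA lerDl addr_ge0 //.
  by apply: sumr_ge0.
rewrite (le_trans _ (_ : 2 <= 2 + S)) ?lerDl //.
have -> : u k = (\sum_(i < k.+1) u i - l) - (\sum_(i < k) u i - l).
  by rewrite big_ord_recr /=; ring.
rewrite (le_trans (ler_normB _ _)) // -[2]/(1 + 1) lerD // ltW // HN //.
by rewrite (leq_trans leNk).
Qed.

(** At the radius [rho] midway between [r] and 1 the terms are bounded by some [M], so those of
    [f (r * w)] are dominated by [M * (r / rho) ^+ k] uniformly in [w], and a partial sum serves as
    [p]. *)
Lemma power_series_approx (c : nat -> C) (f : C -> C) (r e : C) :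
  (forall z, in_disc z -> cconv (fun N => \sum_(k < N) c k * z ^+ k) (f z)) ->
  0 < r -> r < 1 -> 0 < e ->
  exists p : {poly C}, forall w, `|w| <= 1 -> `|p.[w] - f (r * w)| <= e.
Proof.
move=> fE r0 r1 e0; pose rho := (r + 1) / 2.
have two0 : 0 < 2 :> C by [].
have rrho : r < rho by rewrite ltr_pdivlMr // mulr_natr mulr2n ltrD2l.
have rho1 : rho < 1 by rewrite ltr_pdivrMr // mul1r ltrD2r.
have rho0 : 0 < rho by apply: lt_trans rrho.
have rhoD : in_disc rho by rewrite /in_disc gtr0_norm.
have [M M0 Mb] := cconv_terms_bounded (u := fun k => c k * rho ^+ k) (fE _ rhoD).
pose q := r / rho.
have q0 : 0 < q by rewrite divr_gt0.
have q1 : q < 1 by rewrite ltr_pdivrMr // mul1r.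
have k0 : 0 < 1 - q by rewrite subr_gt0.
have cb k w : `|w| <= 1 -> `|c k * (r * w) ^+ k| <= M * q ^+ k.
  move=> w1; have -> : c k * (r * w) ^+ k = c k * rho ^+ k * (q ^+ k * w ^+ k).
    rewrite -mulrA; congr (_ * _); rewrite mulrA -!exprMn /q mulrC.
    by congr (_ ^+ _); field; rewrite gt_eqF.
  rewrite normrM ler_pM // normrM.
  have qk0 : 0 <= q ^+ k by rewrite exprn_ge0 // ltW.
  by rewrite (ger0_norm qk0) ler_piMr // normrX exprn_ile1.
(* This [m] makes the geometric tail [M * q ^+ m / (1 - q)] at most [e]. *)
have [m le_m] := exists_expr_le (ltW q0) q1 (divr_gt0 (mulr_gt0 e0 k0) M0).
exists (\poly_(k < m) (c k * r ^+ k)) => w w1.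
have wD : in_disc (r * w).
  by rewrite /in_disc normrM gtr0_norm // (le_lt_trans _ r1) // ler_piMr // ltW.
have -> : (\poly_(k < m) (c k * r ^+ k)).[w] = \sum_(k < m) c k * (r * w) ^+ k.
  by rewrite horner_poly; apply: eq_bigr => k _; rewrite exprMn mulrA.
(* Convergence at [w] is only pointwise: a longer partial sum, whose length depends on [w], is
   within [e'] of the value, and the degree [m] is unaffected. *)
apply/ler_addgt0Pr => e' e'0; have [N HN] := fE _ wD _ e'0.
have := HN (maxn N m) (leq_maxl _ _).
set S := \sum_(k < m) _; set T := \sum_(k < maxn N m) _ => lt_e'.
have -> : S - f (r * w) = - (T - S) + (T - f (r * w)) by ring.
rewrite (le_trans (ler_normD _ _)) // lerD ?(ltW lt_e') // normrN.
rewrite /T -(subnKC (leq_maxr N m)) big_split_ord /= addrAC subrr add0r.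
rewrite (le_trans (ler_norm_sum _ _ _)) //.
rewrite (le_trans (ler_sum _ (fun i _ => cb _ _ w1))) //.
under eq_bigr do rewrite exprD mulrA.
rewrite -mulr_sumr -/(geom _ q).
have Mq0 : 0 <= M * q ^+ m by rewrite mulr_ge0 ?exprn_ge0 // ltW.
rewrite (le_trans (ler_wpM2l Mq0 (geom_le _ (ltW q0) q1))) //.
by rewrite ler_pdivrMr // mulrC -ler_pdivlMr.
Qed.

End Geometric.

(** * The Schwarz--Pick inequality at [0] and [z] *)

Section Pick.
Set Implicit Arguments.
Unset Strict Implicit.
Variable R : realType.
Local Notation C := R[i].
Variable d : nat.
Implicit Types (x y a b u v : 'cV[C]_d) (A D P : 'M[C]_d).

(** The weights keep the factor of the main term [s] close to 1 when [t] is a small error. *)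
Lemma norm_add_sqr_le (e s t : C) : 0 < e ->
  `|s + t| ^+ 2 <= (1 + e) * `|s| ^+ 2 + (1 + e^-1) * `|t| ^+ 2.
Proof.
move=> e0; have eC : e^* = e by apply/CrealP/gtr0_real.
rewrite -subr_ge0 (_ : _ - _ = e^-1 * `|e * s - t| ^+ 2).
  by rewrite mulr_ge0 ?exprn_ge0 // invr_ge0 ltW.
rewrite !normCK !(rmorphB, rmorphD, rmorphM) /= eC.
by field; rewrite gt_eqF.
Qed.

Lemma norm_mulmx_sqr_le (e : C) D v i : 0 <= e -> (forall i j, `|D i j| <= e) ->
  `|(D *m v) i 0| ^+ 2 <= e ^+ 2 * (d ^ 2)%:R * vnorm2 v.
Proof.
move=> e0 De; have V0 : 0 <= vnorm2 v by rewrite vnorm2_dot dot_ge0.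
have vj j : `|v j 0| <= sqrtC (vnorm2 v).
  rewrite -(@ler_pXn2r _ 2) ?nnegrE ?sqrtC_ge0 // sqrtCK.
  by rewrite /vnorm2 (bigD1 j) //= lerDl sumr_ge0 // => k _; rewrite exprn_ge0.
have le_norm : `|(D *m v) i 0| <= e * d%:R * sqrtC (vnorm2 v).
  rewrite mxE (le_trans (ler_norm_sum _ _ _)) //.
  have -> : e * d%:R * sqrtC (vnorm2 v) = \sum_(j < d) e * sqrtC (vnorm2 v).
    by rewrite sumr_const card_ord -[RHS]mulr_natr mulrAC.
  by apply: ler_sum => j _; rewrite normrM ler_pM.
have -> : e ^+ 2 * (d ^ 2)%:R * vnorm2 v = (e * d%:R * sqrtC (vnorm2 v)) ^+ 2.
  by rewrite !exprMn sqrtCK natrX.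
by rewrite ler_pXn2r ?nnegrE // !mulr_ge0 ?sqrtC_ge0.
Qed.

(** Split [P v = A v + (P - A) v] with weight [e]: the large factor [1 + e^-1] meets an error of
    order [e ^+ 2], so the total loss is of order [e]. *)
Lemma contraction_perturb (e : C) A P v : 0 < e -> e <= 1 -> contraction A ->
  (forall i j, `|P i j - A i j| <= e) ->
  vnorm2 (P *m v) <= (1 + e * (1 + 2 * (d ^ 3)%:R)) * vnorm2 v.
Proof.
move=> e0 e1 contrA PA; have V0 : 0 <= vnorm2 v by rewrite vnorm2_dot dot_ge0.
have De i j : `|(P - A) i j| <= e by rewrite !mxE.
have -> : P *m v = A *m v + (P - A) *m v by rewrite mulmxBl addrC subrK.
apply: (@le_trans _ _ (\sum_(i < d) ((1 + e) * `|(A *m v) i 0| ^+ 2 +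
    (1 + e^-1) * (e ^+ 2 * (d ^ 2)%:R * vnorm2 v)))).
  apply: ler_sum => i _; rewrite mxE (le_trans (norm_add_sqr_le _ _ e0)) //.
  rewrite lerD2l; apply: ler_wpM2l; last exact: norm_mulmx_sqr_le (ltW e0) De.
  by rewrite addr_ge0 // invr_ge0 ltW.
rewrite big_split /= -mulr_sumr sumr_const card_ord -/(vnorm2 (A *m v)).
apply: (@le_trans _ _ ((1 + e) * vnorm2 v + (e ^+ 2 + e) * (d ^ 3)%:R * vnorm2 v)).
  apply: lerD; first by rewrite ler_wpM2l ?addr_ge0 ?contrA // ltW.
  rewrite -mulr_natr [(d ^ 3)%N]expnSr natrM le_eqVlt; apply/orP; left; apply/eqP.
  by field; rewrite gt_eqF.
rewrite -mulrDl ler_wpM2r // mulrDr mulr1 -addrA lerD2l lerD2l mulrA ler_wpM2r //.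
by rewrite mulr_natr mulr2n lerD2r expr2 ler_piMl // ltW.
Qed.

Lemma dot_perturb (e : C) D x u : (forall i j, `|D i j| <= e) ->
  `|dot x (D *m u)| <= e * \sum_i \sum_j `|x i 0| * `|u j 0|.
Proof.
move=> De; rewrite dotE (le_trans (ler_norm_sum _ _ _)) // mulr_sumr.
apply: ler_sum => i _; rewrite mxE mulr_sumr (le_trans (ler_norm_sum _ _ _)) //.
rewrite mulr_sumr; apply: ler_sum => j _.
by rewrite !normrM norm_conjC mulrCA ler_wpM2r ?mulr_ge0.
Qed.

Lemma analytic_approx (psi : C -> 'M[C]_d) (r e : C) : analytic_disc psi ->
  0 < r -> r < 1 -> 0 < e ->
  exists P : 'M[{poly C}]_d, forall w, `|w| <= 1 ->
    forall i j, `|eval_mx P w i j - psi (r * w) i j| <= e.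
Proof.
move=> [c psiE] r0 r1 e0.
have /fin_all_exists[p pE] (ij : 'I_d * 'I_d) : exists p : {poly C},
    forall w, `|w| <= 1 -> `|p.[w] - psi (r * w) ij.1 ij.2| <= e.
  apply: (power_series_approx (c := fun k => c k ij.1 ij.2)
    (f := fun z => psi z ij.1 ij.2)) => // z zD.
  exact: psiE.
exists (\matrix_(i, j) p (i, j)) => w w1 i j.
by rewrite !mxE; apply: (pE (i, j)).
Qed.

Lemma conj_szego_form (k : C) x y : k^* = k -> (szego_form k x y)^* = szego_form k x y.
Proof.
move=> kC; rewrite /szego_form !rmorphD rmorphM /= kC -!dotC.
by rewrite [dot y x + _]addrC.
Qed.

Lemma normr_add_conj (s : C) : `|s + s^*| <= 2 * `|s|.
Proof.
by rewrite (le_trans (ler_normD _ _)) // norm_conjC mulr_natl mulr2n.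
Qed.

Lemma szego_form_le (k l : C) x y : k <= l -> szego_form k x y <= szego_form l x y.
Proof. by move=> kl; rewrite lerD2l ler_wpM2r // dot_ge0. Qed.

(** Apply [poly_pick] to polynomial approximants of [psi (r * _)] and let their error tend to 0. As
    [K] stays fixed, the test vectors do too; the cut [N], which varies with the approximant, is
    removed by bounding the geometric sum by its limit. *)
Lemma pick_truncated (psi : C -> 'M[C]_d) (K : nat) (r z : C) x y a b :
  analytic_disc psi -> (forall z, in_disc z -> contraction (psi z)) ->
  (0 < K)%N -> 0 < r -> r < 1 -> `|z| < 1 ->
  let s := dot x (psi 0 *m (a + b)) +
           dot y (psi (r * z) *m (a + geom K (z^* * z) *: b)) in
  s + s^* <= szego_form (1 - z^* * z)^-1 x y + szego_form (geom K (z^* * z)) a b.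
Proof.
move=> psiA psiC K0 r0 r1 z1; set s := (X in let s := X in _); rewrite [let _ := _ in _]/=.
set q := z^* * z; have qE : q = `|z| ^+ 2 by rewrite normCKC.
have q0 : 0 <= q by rewrite qE exprn_ge0.
have q1 : q < 1 by rewrite qE exprn_ilt1.
pose u := a + b; pose v := a + geom K q *: b.
(* The error is at most [e * T1] from the approximant being only nearly contractive, and [e * T2]
   from replacing [psi] by it in [s]. *)
pose T1 := (1 + 2 * (d ^ 3)%:R) * `|szego_form (geom K q) a b|.
pose T2 := 2 * ((\sum_i \sum_j `|x i 0| * `|u j 0|) +
                (\sum_i \sum_j `|y i 0| * `|v j 0|)).
have T10 : 0 <= T1 by rewrite mulr_ge0 // addr_ge0 // mulr_ge0.
have T20 : 0 <= T2.
  by rewrite mulr_ge0 // addr_ge0 // sumr_ge0 // => i _; rewrite sumr_ge0 // => j _;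
    rewrite mulr_ge0.
apply/ler_addgt0Pr => e' e'0.
pose T := T1 + T2; have T0 : 0 <= T by rewrite addr_ge0.
have eT : 0 < e' + T by rewrite ltr_wpDr.
(* This choice gives both [e <= 1] and [e * T <= e'], even when [T = 0]. *)
pose e := e' / (e' + T).
have e0 : 0 < e by rewrite divr_gt0.
have e1 : e <= 1 by rewrite ler_pdivrMr // mul1r lerDl.
have le_eT : e * T <= e' by rewrite mulrAC ler_pdivrMr // ler_wpM2l ?lerDr // ltW.
have [P PE] := analytic_approx psiA r0 r1 e0.
have contrP w v0 : `|w| = 1 ->
    vnorm2 (eval_mx P w *m v0) <= (1 + e * (1 + 2 * (d ^ 3)%:R)) * vnorm2 v0.
  move=> w1; apply: (@contraction_perturb _ (psi (r * w))) => //.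
    by apply: psiC; rewrite /in_disc normrM w1 mulr1 gtr0_norm.
  by apply: PE; rewrite w1.
have [N] := poly_pick z x y a b K0 contrP.
rewrite /= -/q -/u -/v; set sP := dot x _ + _ => le_sP.
have sPs : s + s^* <= sP + sP^* + e * T2.
  have -> : s + s^* = sP + sP^* + ((s - sP) + (s - sP)^*) by rewrite rmorphB /=; ring.
  rewrite lerD2l.
  have real_s : (s - sP) + (s - sP)^* \is Num.real.
    by apply/CrealP; rewrite rmorphD /= conjCK addrC.
  rewrite (le_trans (real_ler_norm real_s)) // (le_trans (normr_add_conj _)) //.
  rewrite mulrCA ler_wpM2l // mulrDr.
  have -> : s - sP = dot x ((psi 0 - eval_mx P 0) *m u) +
                     dot y ((psi (r * z) - eval_mx P z) *m v).
    by rewrite !mulmxBl !dotDr !dotNr /s /sP -/u -/v; ring.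
  rewrite (le_trans (ler_normD _ _)) // lerD // dot_perturb // => i j.
    have := PE 0; rewrite normr0 mulr0 => /(_ ler01 i j).
    by rewrite !mxE distrC.
  by have := PE z (ltW z1) i j; rewrite !mxE distrC.
apply: (le_trans sPs); apply: (@le_trans _ _ (szego_form (1 - q)^-1 x y +
  (szego_form (geom K q) a b + e * T1) + e * T2)); last first.
  by rewrite -!addrA !lerD2l -mulrDr.
rewrite lerD2r (le_trans le_sP) // lerD ?szego_form_le ?geom_le //.
rewrite mulrDl mul1r lerD2l -mulrA ler_wpM2l ?(ltW e0) // ler_wpM2l //.
  by rewrite addr_ge0 // mulr_ge0.
rewrite real_ler_norm //; apply/CrealP/conj_szego_form.
by apply/CrealP/ger0_real/geom_ge0.
Qed.

(** Choosing [a], [b] as the adjoint values makes the pairing [s] equal to the form of [a, b]. It is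
    real, so [s + s^*] counts it twice; one copy cancels against the right side, and [K] then tends
    to infinity. *)
Lemma pick_radius (psi : C -> 'M[C]_d) (r z : C) x y :
  analytic_disc psi -> (forall z, in_disc z -> contraction (psi z)) ->
  0 < r -> r < 1 -> `|z| < 1 ->
  szego_form (1 - `|z| ^+ 2)^-1 (mxadj (psi 0) *m x) (mxadj (psi (r * z)) *m y) <=
  szego_form (1 - `|z| ^+ 2)^-1 x y.
Proof.
move=> psiA psiC r0 r1 z1; set a := mxadj (psi 0) *m x; set b := mxadj _ *m y.
set q := `|z| ^+ 2; have q0 : 0 <= q by rewrite exprn_ge0.
have q1 : q < 1 by rewrite exprn_ilt1.
have B0 := dot_ge0 b; have B1 : 0 < 1 + dot b b by rewrite ltr_wpDr.
apply/ler_addgt0Pr => e' e'0; pose e := e' / (1 + dot b b).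
have e0 : 0 < e by rewrite divr_gt0.
have [K K0 le_K] := exists_geom_ge q0 q1 e0.
have := pick_truncated (z := z) x y a b psiA psiC K0 r0 r1 z1.
rewrite /= -normCKC -/q !dot_adjr -/a -/b.
have -> : dot a (a + b) + dot b (a + geom K q *: b) = szego_form (geom K q) a b.
  by rewrite !dotDr dotZr /szego_form; ring.
rewrite conj_szego_form; last by apply/CrealP/ger0_real/geom_ge0.
rewrite lerD2r => le_form.
apply: (@le_trans _ _ (szego_form (geom K q + e) a b)); first exact: szego_form_le.
rewrite {1}/szego_form mulrDl addrA lerD // /e mulrAC ler_pdivrMr //.
by rewrite ler_wpM2l ?lerDr // ltW.
Qed.

(* The Schwarz--Pick inequality for the two points [0] and [z]: the kernel
   [(1 - psi(p) psi(q)') / (1 - p q')] is positive on [{0, z}]. *)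
Lemma schwarz_pick (psi : C -> 'M[C]_d) (z : C) x y :
  analytic_disc psi -> (forall z, in_disc z -> contraction (psi z)) -> in_disc z ->
  szego_form (1 - `|z| ^+ 2)^-1 (mxadj (psi 0) *m x) (mxadj (psi z) *m y) <=
  szego_form (1 - `|z| ^+ 2)^-1 x y.
Proof.
rewrite /in_disc => psiA psiC z1; set a := mxadj (psi 0) *m x; set b := mxadj _ *m y.
have Y0 := dot_ge0 y; have Y1 : 0 < 1 + dot y y by rewrite ltr_wpDr.
apply/ler_addgt0Pr => e' e'0; pose e := e' / (1 + dot y y).
have e0 : 0 < e by rewrite divr_gt0.
have t1 : `|z| ^+ 2 < 1 by rewrite exprn_ilt1.
set k := (1 - `|z| ^+ 2)^-1.
have k0 : 0 < k by rewrite invr_gt0 subr_gt0.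
(* The previous lemma is to be used at [z / r], which the dilation by [r] sends back to [z]; the
   price is a slightly larger kernel value. *)
have [r [r0 r1 zr1 zrE]] : exists r : C, [/\ 0 < r, r < 1, `|z / r| < 1 &
    k <= (1 - `|z / r| ^+ 2)^-1 <= k + e].
  have [z0|z0] := eqVneq z 0.
    exists (2^-1); split; rewrite ?invr_gt0 ?invf_lt1 ?ltr1n //.
      by rewrite z0 mul0r normr0.
    by rewrite /k z0 mul0r !normr0 !expr0n /= subr0 invr1 lexx lerDl ltW.
  have nz : 0 < `|z| by rewrite normr_gt0.
  have ke0 : 0 < k + e by rewrite addr_gt0.
  (* Solves [(1 - p)^-1 = k + e]; then [r] is chosen so that [z / r] has squared modulus [p]. *)
  pose p := 1 - (k + e)^-1.
  have lt_tp : `|z| ^+ 2 < p.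
    by rewrite ltrBrDr -ltrBrDl -[1 - _]invrK -/k ltf_pV2 ?posrE // ltrDl.
  have p0 : 0 < p by apply: lt_trans lt_tp; rewrite exprn_gt0.
  have p1 : p < 1 by rewrite ltrBlDr ltrDl invr_gt0.
  have sp0 : 0 < sqrtC p by rewrite sqrtC_gt0.
  pose r := `|z| / sqrtC p.
  have r0 : 0 < r by rewrite divr_gt0.
  have nzr : `|z / r| = sqrtC p.
    rewrite normrM normfV (gtr0_norm r0) /r; field.
    by rewrite !gt_eqF.
  exists r; split=> //.
  - by rewrite ltr_pdivrMr // mul1r -(@ltr_pXn2r _ 2) ?nnegrE ?sqrtCK // ltW.
  - by rewrite nzr -(@ltr_pXn2r _ 2) ?nnegrE ?sqrtCK ?expr1n ?ltW.
  - by rewrite nzr sqrtCK /p opprB addrCA subrr addr0 invrK lexx lerDl ltW.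
have := pick_radius x y psiA psiC r0 r1 zr1.
have -> : r * (z / r) = z by rewrite mulrCA divff ?mulr1 // gt_eqF.
rewrite -/a -/b => le_r; case/andP: zrE => le_k le_ke.
apply: (le_trans (szego_form_le _ _ le_k)); apply: (le_trans le_r).
apply: (le_trans (szego_form_le _ _ le_ke)).
rewrite {1}/szego_form mulrDl addrA lerD // /e mulrAC ler_pdivrMr //.
by rewrite ler_wpM2l ?lerDr // ltW.
Qed.

End Pick.

(** * The matrix exponential near [t = 0] *)

Section Convergence.
Set Implicit Arguments.
Unset Strict Implicit.
Variable R : realType.
Local Notation C := R[i].
Local Notation "t %:C" := (real_complex R t) : ring_scope.

Lemma complex_ge0E (x : C) : 0 <= x -> x = (complex.Re x)%:C.
Proof. by case: x => a b; rewrite lecE /= => /andP[/eqP-> _]. Qed.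

Lemma cconv_lin (a : C) (u v : nat -> C) (l m : C) :
  cconv u l -> cconv v m -> cconv (fun n => u n + a * v n) (l + a * m).
Proof.
move=> ul vm e e0.
have a1 : 0 < 1 + `|a| by rewrite ltr_wpDr.
have [N HN] := ul _ (divr_gt0 e0 (ltr0n _ 2)).
have [M HM] := vm _ (divr_gt0 (divr_gt0 e0 (ltr0n _ 2)) a1).
exists (maxn N M) => n; rewrite geq_max => /andP[/HN un /HM vn].
have -> : u n + a * v n - (l + a * m) = (u n - l) + a * (v n - m) by ring.
rewrite (le_lt_trans (ler_normD _ _)) // [e](splitr e) ltr_leD // normrM.
rewrite ltr_pdivlMr // in vn.
by rewrite (le_trans _ (ltW vn)) // mulrC ler_wpM2l // lerDr.
Qed.

Lemma cconv_norm_le (u : nat -> C) (l c K : C) (N : nat) :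
  cconv u l -> (forall n, (N <= n)%N -> `|u n - c| <= K) -> `|l - c| <= K.
Proof.
move=> ul uK; apply/ler_addgt0Pr => e /ul[M HM].
have := HM _ (leq_maxr N M); have := uK _ (leq_maxl N M); set n := maxn N M => le_c lt_l.
have -> : l - c = (u n - c) - (u n - l) by ring.
by rewrite (le_trans (ler_normB _ _)) // lerD // ltW.
Qed.

(** Nonnegative elements of [R[i]] are real, so the limit is the supremum of the real parts of the
    partial sums. *)
Lemma cconv_series_ge0 (w : nat -> C) (B : C) : (forall k, 0 <= w k) ->
  (forall n, \sum_(k < n) w k <= B) -> exists l, cconv (fun n => \sum_(k < n) w k) l.
Proof.
move=> w0 wB; pose W n := \sum_(k < n) w k.
have W0 n : 0 <= W n by apply: sumr_ge0.
pose E := [set x | exists n, x = complex.Re (W n)]%classic.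
have supE : has_sup E.
  split; first by exists (complex.Re (W 0%N)); exists 0%N.
  exists (complex.Re B) => _ [n ->]; have := wB n; rewrite -/(W n) lecE.
  by case/andP.
exists (sup E)%:C => e e0; have eE := complex_ge0E (ltW e0).
have re0 : 0 < complex.Re e by move: e0; rewrite ltcE => /andP[].
have [_ [N ->] ltN] := sup_adherent re0 supE.
exists N => n leNn; rewrite -/(W n) (complex_ge0E (W0 n)) eE.
have leWn : complex.Re (W N) <= complex.Re (W n).
  have : W N <= W n by rewrite /W -(subnKC leNn) big_split_ord /= lerDl sumr_ge0.
  by rewrite lecE => /andP[].
have le_sup : complex.Re (W n) <= sup E by apply: sup_upper_bound => //; exists n.
rewrite distrC -rmorphB ger0_norm; last by rewrite lecE /= eqxx subr_ge0.
by rewrite ltcE /= eqxx ltrBlDr -ltrBlDl (lt_le_trans ltN).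
Qed.

(** Reduce to nonnegative terms: ['Re (v k) + b k] lies between 0 and [2 b k]. Taking [v = u] and
    [v = - 'i * u] yields the real and imaginary parts. *)
Lemma cconv_series_dominated (u b : nat -> C) (B : C) : (forall k, `|u k| <= b k) ->
  (forall n, \sum_(k < n) b k <= B) -> exists l, cconv (fun n => \sum_(k < n) u k) l.
Proof.
move=> ub bB; have b0 k : 0 <= b k by apply: le_trans (ub k).
have [lb bl] := cconv_series_ge0 b0 bB.
have re_conv (v : nat -> C) : (forall k, `|v k| <= b k) ->
    exists l, cconv (fun n => \sum_(k < n) 'Re (v k)) l.
  move=> vb; have re_le k : `|'Re (v k)| <= b k.
    by rewrite (le_trans _ (vb k)) // leif_normC_Re_Creal.
  have re_b k : 0 <= 'Re (v k) + b k <= b k + b k.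
    have := re_le k; rewrite real_ler_norml ?Creal_Re // => /andP[le1 le2].
    by rewrite -lerBlDr sub0r le1 lerD2r.
  have [l vl] : exists l, cconv (fun n => \sum_(k < n) ('Re (v k) + b k)) l.
    apply: (cconv_series_ge0 (w := fun k => 'Re (v k) + b k) (B := B + B)) => [k|n].
      by case/andP: (re_b k).
    apply: le_trans (lerD (bB n) (bB n)); rewrite -big_split /=.
    by apply: ler_sum => k _; case/andP: (re_b k).
  exists (l + -1 * lb); have := cconv_lin (-1) vl bl.
  congr cconv; apply/funext => n; rewrite mulN1r -sumrB.
  by apply: eq_bigr => k _; rewrite addrK.
have [l1 ul1] := re_conv u ub.
have [|l2 ul2] := re_conv (fun k => - 'i * u k).
  by move=> k; rewrite normrM normrN normCi mul1r.
exists (l1 + 'i * l2); have := cconv_lin 'i ul1 ul2.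
congr cconv; apply/funext => n; rewrite mulr_sumr -big_split /=.
by apply: eq_bigr => k _; rewrite mulNr raddfN /= ReMil opprK -Crect.
Qed.

Lemma exp_series_bounded (B : C) : 0 <= B ->
  exists2 E, 0 <= E & forall n, \sum_(k < n) (k`!%:R)^-1 * B ^+ k <= E.
Proof.
move=> B0; have [m le_m] := complex_archi (mulr_ge0 (ler0n _ 2) B0).
pose a k := (k`!%:R)^-1 * B ^+ k : C.
have a0 k : 0 <= a k by rewrite mulr_ge0 ?exprn_ge0 // invr_ge0.
pose S n := \sum_(k < n) a k.
have S0 n : 0 <= S n by apply: sumr_ge0.
have a_half k : (m <= k)%N -> 2 * a k.+1 <= a k.
  move=> lemk; rewrite /a factS natrM invfM exprSr.
  have -> : 2 * (k.+1%:R^-1 / k`!%:R * (B ^+ k * B)) =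
            (2 * B / k.+1%:R) * (k`!%:R^-1 * B ^+ k) by ring.
  rewrite ler_piMl ?(a0 k) // ler_pdivrMr ?ltr0n // mul1r (le_trans le_m) //.
  by rewrite ler_nat leqW.
(* Once terms at least halve, the partial sum plus twice the next term no longer increases, which
   bounds all partial sums. *)
have S_le n : S (m + n)%N + 2 * a (m + n)%N <= S m + 2 * a m.
  elim: n => [|n IHn]; first by rewrite addn0.
  apply: le_trans IHn; rewrite addnS {1}/S big_ord_recr /= -/(S _) -addrA lerD2l.
  rewrite [2 * a (m + n)%N]mulrDl mul1r lerD2l.
  by rewrite a_half // leq_addr.
exists (S m + 2 * a m) => [|n]; first by rewrite addr_ge0 // mulr_ge0.
apply: le_trans (S_le n); rewrite -/(S n) -[X in X <= _]addr0.
rewrite lerD ?(mulr_ge0 (ler0n _ 2) (a0 _)) //.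
by rewrite /S addnC big_split_ord /= lerDl sumr_ge0.
Qed.

End Convergence.

Section Exponential.
Set Implicit Arguments.
Unset Strict Implicit.
Variable R : realType.
Local Notation C := R[i].
Local Notation "t %:C" := (real_complex R t) : ring_scope.
Variable d : nat.
Implicit Types (M L : 'M[C]_d) (W E : R -> 'M[C]_d).

Lemma real_complex_ge0 (t : R) : 0 <= t -> 0 <= t%:C.
Proof. by rewrite lecE /= eqxx. Qed.

Lemma real_complex_le1 (t : R) : t <= 1 -> t%:C <= 1.
Proof. by rewrite lecE /= eqxx. Qed.

Lemma expr_scalemx (a : C) M k : (a *: M) ^+ k = a ^+ k *: M ^+ k.
Proof.
elim: k => [|k IHk]; first by rewrite !expr0 scale1r.
rewrite !exprSr IHk -[LHS]/((a ^+ k *: M ^+ k) *m (a *: M)).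
by rewrite -scalemxAl -scalemxAr scalerA.
Qed.

Lemma norm_expr_mx_le M (B : C) k i j :
  (forall j, \sum_l `|M l j| <= B) -> 0 <= B -> `|(M ^+ k) i j| <= B ^+ k.
Proof.
move=> MB B0; elim: k i j => [|k IHk] i j.
  by rewrite !expr0 mxE; case: eqP; rewrite ?normr1 ?normr0.
rewrite exprSr mxE (le_trans (ler_norm_sum _ _ _)) // exprSr.
apply: le_trans (ler_wpM2l (exprn_ge0 k B0) (MB j)); rewrite mulr_sumr.
by apply: ler_sum => l _; rewrite normrM ler_wpM2r.
Qed.

(** The terms of order at least 2 carry [t ^+ k <= t ^+ 2]; what remains is dominated by the scalar
    exponential series of [B]. *)
Lemma mexp_expansion M : exists K : C, forall t : R, 0 <= t <= 1 -> forall i j,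
  `|mexp (t%:C *: M) i j - ((1%:M : 'M[C]_d) i j + t%:C * M i j)| <= K * t%:C ^+ 2.
Proof.
pose B : C := \sum_j \sum_l `|M l j|.
have B0 : 0 <= B by apply: sumr_ge0 => j _; apply: sumr_ge0.
have MB j : \sum_l `|M l j| <= B.
  rewrite /B [X in _ <= X](bigD1 j) //= lerDl.
  by apply: sumr_ge0 => k _; apply: sumr_ge0.
have [K K0 HK] := exp_series_bounded B0.
exists K => t /andP[t0 t1] i j.
have tC0 := real_complex_ge0 t0; have tC1 := real_complex_le1 t1.
pose u i j k := ((k`!%:R)^-1 *: (t%:C *: M) ^+ k) i j.
have uE i' j' k : u i' j' k = t%:C ^+ k * ((k`!%:R)^-1 * (M ^+ k) i' j').
  by rewrite /u expr_scalemx !mxE; ring.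
have u_le i' j' k : `|u i' j' k| <= t%:C ^+ k * ((k`!%:R)^-1 * B ^+ k).
  have tk0 : 0 <= t%:C ^+ k by rewrite exprn_ge0.
  have fk0 : 0 <= (k`!%:R)^-1 :> C by rewrite invr_ge0.
  rewrite uE normrM (ger0_norm tk0) ler_wpM2l // normrM (ger0_norm fk0).
  by rewrite ler_wpM2l // norm_expr_mx_le.
(* Since [mexp] is an [xget] with default 0, a limit must be exhibited before [mexp] is known to be
   one. *)
have [L LE] : exists L, is_mexp (t%:C *: M) L.
  have /fin_all_exists[l lE] (ij : 'I_d * 'I_d) :
      exists l, cconv (fun n => \sum_(k < n) u ij.1 ij.2 k) l.
    apply: (cconv_series_dominated (b := fun k => (k`!%:R)^-1 * B ^+ k) _ HK) => k.
    apply: le_trans (u_le _ _ _) _.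
    by rewrite ler_piMl ?exprn_ile1 // mulr_ge0 ?exprn_ge0 // invr_ge0.
  exists (\matrix_(i, j) l (i, j)) => i' j'; rewrite mxE.
  have := lE (i', j'); congr cconv; apply/funext => n.
  by rewrite summxE.
have := xgetPex 0 (ex_intro [set E | is_mexp (t%:C *: M) E]%classic L LE).
rewrite /= -/(mexp _) => /(_ i j) expE.
apply: (cconv_norm_le (N := 2) expE) => n; case: n => [|[|n]] // _.
have -> : (\sum_(k < n.+2) (k`!%:R)^-1 *: (t%:C *: M) ^+ k) i j =
    \sum_(k < n.+2) u i j k by rewrite summxE.
have -> : (1%:M : 'M[C]_d) i j = u i j 0%N by rewrite uE !expr0 fact0 invr1 !mul1r.
have -> : t%:C * M i j = u i j 1%N by rewrite uE !expr1 factS fact0 invr1 !mul1r.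
have split2 (v : nat -> C) :
    \sum_(k < n.+2) v k = (v 0%N + v 1%N) + \sum_(k < n) v k.+2.
  by rewrite !big_ord_recl addrA.
rewrite split2 addrAC subrr add0r (le_trans (ler_norm_sum _ _ _)) // mulrC.
apply: le_trans (ler_wpM2l (exprn_ge0 2 tC0) (HK n.+2)).
have term0 k : 0 <= (k`!%:R)^-1 * B ^+ k by rewrite mulr_ge0 ?exprn_ge0 // invr_ge0.
rewrite (split2 (fun k => (k`!%:R)^-1 * B ^+ k)) mulrDr.
apply: (@le_trans _ _ (t%:C ^+ 2 * \sum_(k < n) (k.+2`!%:R)^-1 * B ^+ k.+2)).
  rewrite mulr_sumr; apply: ler_sum => k _; apply: le_trans (u_le _ _ _) _.
  by rewrite ler_wpM2r // ler_wiXn2l.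
by rewrite lerDr mulr_ge0 ?exprn_ge0 // addr_ge0.
Qed.

End Exponential.

(** * First-order calculus at the identity for curves of matrices *)

Section Tangent.
Set Implicit Arguments.
Unset Strict Implicit.
Variable R : realType.
Local Notation C := R[i].
Local Notation "t %:C" := (real_complex R t) : ring_scope.
Variable d : nat.
Implicit Types (L M : 'M[C]_d) (E V W : R -> 'M[C]_d).

Definition bounded01 W := exists K : C,
  forall t : R, 0 <= t <= 1 -> forall i j, `|W t i j| <= K.

(** Says [E 0 = 1] and [E'(0) = L] with a quadratic remainder, without limits. The nested form lets
    factors [t] be cancelled one at a time. *)
Definition tangent E L := exists2 W, bounded01 W &
  forall t : R, 0 <= t <= 1 -> E t = 1%:M + t%:C *: (L + t%:C *: W t).

Lemma bounded01_cst L : bounded01 (fun=> L).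
Proof.
exists (\sum_i \sum_j `|L i j|) => t _ i j.
rewrite (bigD1 i) //= (bigD1 j) //= -addrA lerDl addr_ge0 //.
  by apply: sumr_ge0.
by apply: sumr_ge0 => k _; apply: sumr_ge0.
Qed.

Lemma bounded01D V W : bounded01 V -> bounded01 W -> bounded01 (fun t => V t + W t).
Proof.
move=> [K HK] [K' HK']; exists (K + K') => t t01 i j.
by rewrite mxE (le_trans (ler_normD _ _)) // lerD ?HK ?HK'.
Qed.

Lemma bounded01N W : bounded01 W -> bounded01 (fun t => - W t).
Proof. by move=> [K HK]; exists K => t t01 i j; rewrite mxE normrN HK. Qed.

Lemma bounded01Z W : bounded01 W -> bounded01 (fun t => t%:C *: W t).
Proof.
move=> [K HK]; exists K => t t01 i j; rewrite mxE normrM (le_trans _ (HK t t01 i j)) //.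
case/andP: t01 => /(@real_complex_ge0 R) t0 /(@real_complex_le1 R) t1.
by rewrite ger0_norm // ler_piMl.
Qed.

Lemma bounded01M V W : bounded01 V -> bounded01 W -> bounded01 (fun t => V t *m W t).
Proof.
move=> [K HK] [K' HK']; exists (d%:R * (K * K')) => t t01 i j.
rewrite mxE (le_trans (ler_norm_sum _ _ _)) //.
have -> : d%:R * (K * K') = \sum_(k < d) K * K'.
  by rewrite sumr_const card_ord mulr_natl.
by apply: ler_sum => k _; rewrite normrM ler_pM ?HK ?HK'.
Qed.

Lemma bounded01_small L W : bounded01 W ->
  (forall t : R, 0 < t -> t <= 1 -> L = t%:C *: W t) -> L = 0.
Proof.
move=> [K HK] LW; apply/matrixP => i j; rewrite [RHS]mxE.
have K0 : 0 <= K by apply: le_trans (HK 0 _ i j); rewrite ?normr_ge0 // lexx ler01.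
apply/eqP; rewrite -normr_le0; apply/ler_addgt0Pr => e e0; rewrite add0r.
have eK : 0 < e + K by rewrite ltr_wpDr.
have s0 : 0 < e / (e + K) by rewrite divr_gt0.
(* The entry is at most [t * K], so [t = e / (e + K)] brings it below [e] while keeping [t <= 1]. *)
have sE := complex_ge0E (ltW s0); set t := complex.Re _ in sE.
have t0 : 0 < t by move: s0; rewrite sE ltcE /= eqxx.
have t1 : t <= 1.
  have : e / (e + K) <= 1 by rewrite ler_pdivrMr // mul1r lerDl.
  by rewrite sE lecE /= => /andP[].
rewrite (LW t t0 t1) mxE normrM -sE (ger0_norm (ltW s0)).
have := HK t _ i j; rewrite (ltW t0) t1 => /(_ isT) le_K.
rewrite (le_trans (ler_wpM2l (ltW s0) le_K)) // mulrAC ler_pdivrMr //.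
by rewrite ler_wpM2l ?lerDr // ltW.
Qed.

Lemma tangent_mexp M : tangent (fun t => mexp (t%:C *: M)) M.
Proof.
have [K HK] := mexp_expansion M.
pose W (t : R) := (t%:C ^+ 2)^-1 *: (mexp (t%:C *: M) - (1%:M + t%:C *: M)).
have real_neq0 (t : R) : t != 0 -> t%:C != 0 by move=> t0; rewrite fmorph_eq0.
exists W => [|t t01].
  exists K => t t01 i j.
  have [->|t0] := eqVneq t 0.
    (* At [t = 0] the inverse is 0 by convention, so only [0 <= K] is needed; it is read off from
       the expansion at [t = 1]. *)
    rewrite /W !mxE rmorph0 expr0n /= invr0 mul0r normr0.
    have := HK 1; rewrite lexx ler01 => /(_ isT i j) /(le_trans (normr_ge0 _)).
    by rewrite rmorph1 expr1n mulr1.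
  have tC0 : 0 < t%:C ^+ 2.
    rewrite exprn_gt0 // lt_neqAle eq_sym real_neq0 // real_complex_ge0 //.
    by case/andP: t01.
  rewrite /W !mxE normrM normfV (gtr0_norm tC0) mulrC ler_pdivrMr //.
  by have := HK t t01 i j; rewrite !mxE.
have [t0|t0] := eqVneq t 0.
  apply/matrixP => i j; apply/eqP; rewrite -subr_eq0 -normr_le0.
  have := HK t t01 i j; rewrite t0 !mxE rmorph0 !mul0r expr0n /= mulr0 addr0.
  by [].
rewrite /W scalerDr !scalerA -expr2 divff ?expf_neq0 ?real_neq0 // scale1r.
by rewrite addrA addrC subrK.
Qed.

Lemma tangent1 : tangent (fun=> 1%:M) 0.
Proof.
exists (fun=> 0) => [|t _]; first exact: bounded01_cst.
by rewrite scaler0 addr0 scaler0 addr0.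
Qed.

Lemma mul_tangent (t : R) (S S' : 'M[C]_d) : (1%:M + t%:C *: S) *m (1%:M + t%:C *: S') =
  1%:M + t%:C *: (S + S' + t%:C *: (S *m S')).
Proof.
rewrite mulmxDl mul1mx mulmxDr mulmx1 -scalemxAl -scalemxAr -addrA; congr (_ + _).
by rewrite [S + S']addrC -addrA !scalerDr.
Qed.

Lemma tangentM E L E' L' : tangent E L -> tangent E' L' ->
  tangent (fun t => E t *m E' t) (L + L').
Proof.
move=> [W bW EW] [W' bW' EW'].
exists (fun t => W t + W' t + (L + t%:C *: W t) *m (L' + t%:C *: W' t)).
  apply: bounded01D; first exact: bounded01D.
  by apply: bounded01M; apply: bounded01D; (exact: bounded01_cst || exact: bounded01Z).
move=> t t01; rewrite EW // EW' // mul_tangent; congr (_ + _ *: _).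
by rewrite addrACA !scalerDr !addrA.
Qed.

Lemma eq_tangent E E' L : (forall t : R, 0 <= t <= 1 -> E t = E' t) ->
  tangent E L -> tangent E' L.
Proof. by move=> EE' [W bW EW]; exists W => // t t01; rewrite -EE' // EW. Qed.

Lemma real_complex_gt0_neq0 (t : R) : 0 < t -> t%:C != 0.
Proof. by move=> t0; rewrite fmorph_eq0 gt_eqF. Qed.

Lemma tangent_uniq E L L' : tangent E L -> tangent E L' -> L = L'.
Proof.
move=> [W bW EW] [W' bW' EW']; apply/eqP; rewrite -subr_eq0; apply/eqP.
apply: (bounded01_small (W := fun t => W' t - W t)).
  by apply: bounded01D => //; apply: bounded01N.
move=> t t0 t1; have t01 : 0 <= t <= 1 by rewrite ltW.
have /addrI/(scalerI (real_complex_gt0_neq0 t0)) eqL := etrans (esym (EW t t01)) (EW' t t01).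
apply/eqP; rewrite subr_eq scalerBr addrAC eq_sym subr_eq addrC.
by rewrite eqL addrC.
Qed.

(** The terms of order [t] are symmetric in the two curves, so the commutator of [L] and [L'] is
    seen at order [t ^+ 2]: cancelling 1, [t], the symmetric part and [t] again leaves it equal to
    [t] times a bounded matrix. *)
Lemma tangent_commute E L E' L' : tangent E L -> tangent E' L' ->
  (forall t : R, 0 <= t <= 1 -> E t *m E' t = E' t *m E t) -> L *m L' = L' *m L.
Proof.
move=> [W bW EW] [W' bW' EW'] comm; apply/eqP; rewrite -subr_eq0; apply/eqP.
pose V t := L' *m W t + W' t *m L + t%:C *: (W' t *m W t).
pose V' t := L *m W' t + W t *m L' + t%:C *: (W t *m W' t).
have cst := bounded01_cst.
have bV : bounded01 V.
  by apply: bounded01D; [apply: bounded01D|apply: bounded01Z]; apply: bounded01M.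
have bV' : bounded01 V'.
  by apply: bounded01D; [apply: bounded01D|apply: bounded01Z]; apply: bounded01M.
apply: (bounded01_small (W := fun t => V t - V' t)).
  by apply: bounded01D => //; apply: bounded01N.
move=> t t0 t1; have t01 : 0 <= t <= 1 by rewrite ltW.
have expand (S S' T T' : 'M[C]_d) : (S + t%:C *: T) *m (S' + t%:C *: T') =
    S *m S' + t%:C *: (S *m T' + T *m S' + t%:C *: (T *m T')).
  rewrite mulmxDl !mulmxDr -!scalemxAl -!scalemxAr !scalerDr !scalerA -!addrA.
  by congr (_ + _).
have t_inj := scalerI (real_complex_gt0_neq0 t0).
have := comm t t01; rewrite EW // EW' // !mul_tangent => /addrI/t_inj.
rewrite [X in _ = X + _]addrC => /addrI/t_inj; rewrite !expand => eqLL.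
apply/eqP; rewrite subr_eq scalerBr addrAC eq_sym subr_eq addrC.
by rewrite /V /V' addrC [_ + L' *m L]addrC -eqLL.
Qed.

End Tangent.

(** * Cayley transforms of a factorizing tuple *)

Section Cayley.
Set Implicit Arguments.
Unset Strict Implicit.
Variable R : realType.
Local Notation C := R[i].
Local Notation "t %:C" := (real_complex R t) : ring_scope.
Variable d : nat.
Implicit Types (L M N : 'M[C]_d) (u v w x y : 'cV[C]_d).

Lemma mulmx_ext M N : (forall v, M *m v = N *m v) -> M = N.
Proof.
move=> MN; apply/matrixP => i j; have /matrixP/(_ i 0) := MN (delta_mx j 0).
by rewrite -!colE !mxE.
Qed.

Lemma unitmx_injective M : (forall v, M *m v = 0 -> v = 0) -> M \in unitmx.
Proof.
move=> M0; rewrite -unitmx_tr -row_free_unit -kermx_eq0; apply/eqP/row_matrixP => i.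
rewrite row0; apply: trmx_inj; rewrite trmx0; apply: M0.
by apply: trmx_inj; rewrite trmx_mul trmxK trmx0 -row_mul mulmx_ker row0.
Qed.

(** With [X] the inverse of [M - 1], the transform is [1 + 2 X]; subtracting 1 leaves the invertible
    [2 X], and adding 1 gives [2 M X]. *)
Lemma cayleyK M : M - 1%:M \in unitmx ->
  M = (cayley M + 1%:M) *m invmx (cayley M - 1%:M).
Proof.
move=> Mu; set X := invmx (M - 1%:M).
have XK : (M - 1%:M) *m X = 1%:M by rewrite mulmxV.
have cayE : cayley M = 1%:M + 2 *: X.
  rewrite -XK /cayley -/X -[2 *: X]mul1mx -scalemxAr scalemxAl -mulmxDl.
  by congr (_ *m _); rewrite scaler_nat mulr2n addrA subrK.
have subE : cayley M - 1%:M = 2 *: X by rewrite cayE addrAC subrr add0r.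
have addE : cayley M + 1%:M = M *m (2 *: X).
  rewrite cayE -scalemxAr -[X in X *m _](subrK 1%:M M) mulmxDl XK mul1mx scalerDr.
  by rewrite addrAC -mulr2n -scaler_nat.
have XU : 2 *: X \in unitmx by rewrite unitmxZ ?unitmx_inv // unitfE pnatr_eq0.
by rewrite addE subE mulmxK.
Qed.

Lemma cayley_scalar (z : C) : cayley (z *: 1%:M : 'M[C]_d) = (zeta z)%:M.
Proof.
rewrite /cayley scalemx1 -raddfD -raddfB invmx_scalar -scalar_mxM.
by [].
Qed.

(** Both factors are polynomials or inverses of polynomials in [M]. The swapped order is the one met
    when taking adjoints in [pick_cayley]. *)
Lemma cayleyC M : M - 1%:M \in unitmx -> cayley M = invmx (M - 1%:M) *m (M + 1%:M).
Proof.
move=> Mu; apply: (can_inj (mulKmx Mu)); rewrite mulKVmx // /cayley mulmxA.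
apply: (can_inj (mulmxK Mu)); rewrite mulmxKV //.
rewrite !mulmxDl !mulmxDr !mulmxN !mulNmx !mulmx1 !mul1mx !addrA.
by congr (_ - _); rewrite addrAC.
Qed.

(** Constant functions are the test functions that turn identities of operators on the Hardy space
    into matrix identities at each [z]. *)
Lemma inH2_cst v : inH2 (fun=> v).
Proof.
exists (fun k : nat => if k == 0%N then v else 0); split.
  exists (vnorm2 v) => -[|N]; first by rewrite big_ord0 vnorm2_dot dot_ge0.
  rewrite big_ord_recl big1 ?addr0 // => k _.
  by rewrite vnorm2_dot dot0r.
move=> z _ i e e0; exists 1%N => -[|N] // _.
rewrite big_ord_recl big1 => [|k _]; last by rewrite mxE mul0r.
by rewrite expr0 mulr1 addr0 subrr normr0.
Qed.

Lemma factorizing_cayley n (psi : 'I_n -> C -> 'M[C]_d) z : factorizing psi -> in_disc z ->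
  (forall j k, cayley (psi j z) *m cayley (psi k z) = cayley (psi k z) *m cayley (psi j z)) /\
  \sum_j cayley (psi j z) = (zeta z)%:M.
Proof.
move=> [_ comm fact] zD; split=> [j k|].
  apply: tangent_commute (tangent_mexp _) (tangent_mexp _) _ => t /andP[t0 _].
  have := fun v => comm j k t t0 _ (inH2_cst v) z zD.
  rewrite -!/(phi_op t _) /Mop /phicomp; move: (phi_op t _) (phi_op t _) => P Q PQ.
  by apply: mulmx_ext => v; rewrite -!mulmxA PQ.
(* The product of the exponentials at [z] has two tangents, the sum of the Cayley transforms by the
   product rule and [zeta z] times the identity by the factorization; they must agree. *)
pose E t := foldr (fun j X => phicomp t (psi j) z *m X) 1%:M (enum 'I_n).
have tE : tangent E (\sum_(j <- enum 'I_n) cayley (psi j z)).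
  rewrite /E; elim: (enum 'I_n) => [|j s IHs] /=.
    by rewrite big_nil; apply: tangent1.
  by rewrite big_cons; apply: tangentM IHs; apply: tangent_mexp.
have tE' : tangent E (cayley (@zmat R d z)).
  apply: eq_tangent (tangent_mexp _) => t /andP[t0 _]; apply: mulmx_ext => v.
  have := fact t t0 _ (inH2_cst v) z zD.
  rewrite /prodMop /Mop /phicomp /phi_op => <-; rewrite /E.
  elim: (enum 'I_n) => [|j s /= ->]; first by rewrite /= mul1mx.
  by rewrite mulmxA.
rewrite -cayley_scalar -(tangent_uniq tE tE') big_enum //.
Qed.

(** The quadratic form of the kernel [(G(p) + G(q)') / (1 - p q')] on the points 0 and [z]; the
    denominator is 1 unless [p = q = z]. *)
Definition pick_form (G0 G : 'M[C]_d) (k : C) u v : C :=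
  dot u ((G0 + mxadj G0) *m u) +
  (dot u ((G0 + mxadj G) *m v) + (dot u ((G0 + mxadj G) *m v))^*) +
  k * dot v ((G + mxadj G) *m v).

(** Take [x], [y] in Schwarz--Pick so that [a - x = u] and [b - y = v]; then [a + x] and [b + y] are
    the adjoint Cayley transforms applied to [u] and [v]. Polarization, as in
    [Re <a - x, a + x> = |a|^2 - |x|^2], makes the form twice the Schwarz--Pick difference. *)
Lemma pick_cayley (psi : C -> 'M[C]_d) z u v : classC psi -> in_disc z ->
  pick_form (cayley (psi 0)) (cayley (psi z)) (1 - `|z| ^+ 2)^-1 u v <= 0.
Proof.
move=> [psiA psiC psi1] zD.
have unit1 (w : C) : in_disc w -> psi w - 1%:M \in unitmx.
  move=> wD; apply: unitmx_injective => v0; rewrite mulmxBl mul1mx => /eqP.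
  by rewrite subr_eq0 => /eqP/(psi1 w wD).
have D0 : in_disc (0 : C) by rewrite /in_disc normr0.
pose X (w : C) (t : 'cV[C]_d) : 'cV[C]_d := mxadj (invmx (psi w - 1%:M)) *m t.
have XB (w : C) t : in_disc w -> mxadj (psi w) *m X w t - X w t = t.
  move=> wD; rewrite -{2}[X w t]mul1mx -mulmxBl -[1%:M]mxadj1 -mxadjN -mxadjD.
  by rewrite mulmxA -mxadjM mulVmx ?unit1 // mxadj1 mul1mx.
have XD (w : C) t : in_disc w -> mxadj (psi w) *m X w t + X w t = mxadj (cayley (psi w)) *m t.
  move=> wD; rewrite -{2}[X w t]mul1mx -mulmxDl -[1%:M]mxadj1 -mxadjD.
  by rewrite mulmxA -mxadjM -cayleyC ?unit1.
have := schwarz_pick (X 0 u) (X z v) psiA psiC zD.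
set k := (_ - _)^-1; rewrite -subr_le0.
set x := X 0 u; set y := X z v; set a := mxadj (psi 0) *m x; set b := mxadj (psi z) *m y.
have axB : a - x = u by apply: XB.
have byB : b - y = v by apply: XB.
have axD : a + x = mxadj (cayley (psi 0)) *m u by apply: XD.
have byD : b + y = mxadj (cayley (psi z)) *m v by apply: XD.
move: (cayley (psi 0)) (cayley (psi z)) axD byD => G0 G axD byD.
clearbody a b x y k.
have e1 (K : 'M[C]_d) (s t p : 'cV[C]_d) :
    mxadj K *m s = p -> dot s (K *m t) = dot p t by rewrite dot_adjr => ->.
have -> : pick_form G0 G k u v =
   2 * (szego_form k a b - szego_form k x y).
  rewrite /pick_form !mulmxDl !dotDr !(e1 _ _ _ _ (esym axD)) (e1 _ _ _ _ (esym byD)).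
  rewrite -axD -byD -axB -byB /szego_form !(dotDl, dotDr, dotNl, dotNr).
  by rewrite !(rmorphD, rmorphN) /= -!dotC; ring.
by move=> le0; rewrite mulr_ge0_le0.
Qed.

End Cayley.

(** * Rigidity *)

Section Rigidity.
Set Implicit Arguments.
Unset Strict Implicit.
Variable R : realType.
Local Notation C := R[i].
Variable d : nat.
Implicit Types (G H M N : 'M[C]_d) (u v w p : 'cV[C]_d).

(** At a maximum the gradient vanishes. The proof moves from [p0] by a small step [s] along the
    gradient [p] itself, where the value is [s * (2 * dot p p + s * h)]. *)
Lemma herm_quad_max H p0 w (c : C) : mxadj H = H ->
  (forall u, dot u (H *m u) + (dot u w + (dot u w)^*) + c <= 0) ->
  dot p0 (H *m p0) + (dot p0 w + (dot p0 w)^*) + c = 0 -> H *m p0 + w = 0.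
Proof.
move=> HH le0 eq0; set p := H *m p0 + w.
have eH : H *m p0 = p - w by rewrite addrK.
clearbody p.
have P0 := dot_ge0 p.
pose h := dot p (H *m p).
have hr : h \is Num.real by apply/CrealP; rewrite /h -dotC dot_adjr HH.
suff : dot p p <= 0 by move=> P1; apply: dot_eq0; apply/eqP; rewrite eq_le P0 P1.
apply/ler_addgt0Pr => e e0; rewrite add0r.
have eh : 0 < e + `|h| by rewrite ltr_wpDr.
pose s := e / (e + `|h|); have s0 : 0 < s by rewrite divr_gt0.
have sC : s^* = s by apply/CrealP/gtr0_real.
have le_se : s * `|h| <= e.
  by rewrite mulrAC ler_pdivrMr // ler_wpM2l ?lerDr // ltW.
clearbody s; have := le0 (p0 + s *: p).
have -> : dot (p0 + s *: p) (H *m (p0 + s *: p)) +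
    (dot (p0 + s *: p) w + (dot (p0 + s *: p) w)^*) + c = s * (2 * dot p p + s * h).
  rewrite -[RHS]addr0 -[X in _ = _ + X]eq0 mulmxDr -scalemxAr !(dotDl, dotDr, dotZl, dotZr) sC.
  rewrite !(rmorphD, rmorphM) /= sC -!dotC -/h.
  have -> : dot p0 (H *m p) = dot p p - dot w p.
    by rewrite dot_adjr HH eH dotDl dotNl.
  by rewrite eH !dotDr !dotNr; ring.
rewrite pmulr_rle0 // => le2.
have le_sh : - (s * h) <= e.
  by rewrite -mulrN (le_trans _ le_se) // ler_wpM2l ?(ltW s0) // -normrN real_ler_norm // realN.
apply: le_trans le_sh; rewrite -subr_le0 opprK (le_trans _ le2) // lerD2r.
by rewrite mulr_natl mulr2n lerDl.
Qed.

Lemma pick_form_sum n (G0 G : 'I_n -> 'M[C]_d) k u v :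
  \sum_j pick_form (G0 j) (G j) k u v = pick_form (\sum_j G0 j) (\sum_j G j) k u v.
Proof.
have adj_sum (F : 'I_n -> 'M[C]_d) : mxadj (\sum_j F j) = \sum_j mxadj (F j).
  apply: (big_morph (@mxadj R d d) (@mxadjD R d d)).
  by apply/matrixP => i j; rewrite !mxE conjC0.
rewrite /pick_form !adj_sum -!big_split !mulmx_suml !dot_sumr rmorph_sum mulr_sumr.
by rewrite -!big_split.
Qed.

(** For [zeta] the form is minus twice the squared norm of [u + v / (1 - z')], and the vector [u]
    given here makes it vanish. *)
Lemma pick_form_zeta (z : C) v : in_disc z ->
  pick_form (-1)%:M (zeta z)%:M (1 - `|z| ^+ 2)^-1 (- ((1 - z)^-1)^* *: v) v = 0.
Proof.
rewrite /in_disc => z1; have ne1 (w : C) : `|w| < 1 -> 1 - w != 0.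
  by move=> w1; rewrite subr_eq0 eq_sym; apply: contraTneq w1 => ->; rewrite normr1 ltxx.
have z10 := ne1 _ z1; have zC10 : 1 - z^* != 0 by rewrite ne1 // norm_conjC.
have zz0 : 1 - z * z^* != 0 by rewrite ne1 // -normCK normrX normr_id exprn_ilt1.
have adj_scal (a : C) : mxadj (a%:M : 'M[C]_d) = (a^*)%:M.
  by rewrite -scalemx1 mxadjZ mxadj1 scalemx1.
rewrite /pick_form !adj_scal -!raddfD !mul_scalar_mx !dotZl !dotZr /zeta normCK.
rewrite !(rmorphN, rmorphD, rmorphM, rmorphB, fmorphV, rmorph1) /= !conjCK -!dotC.
field.
by rewrite zC10 zz0 z10 -opprB oppr_eq0 zC10 -opprB oppr_eq0 z10.
Qed.

Lemma zeta_inv (z : C) : in_disc z -> (1 - z)^-1 = (1 - zeta z) / 2.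
Proof.
move=> z1; have z10 : z - 1 != 0.
  by rewrite subr_eq0; apply: contraTneq z1 => ->; rewrite /in_disc normr1 ltxx.
rewrite /zeta; field; rewrite z10 /=.
by rewrite -opprB oppr_eq0.
Qed.

Lemma cayley_rigid n (psi : 'I_n -> C -> 'M[C]_d) z j : factorizing psi -> in_disc z ->
  let G0 := cayley (psi j 0) in
  cayley (psi j z) = 2^-1 *: (G0 - mxadj G0) + zeta z *: (- 2^-1 *: (G0 + mxadj G0)).
Proof.
move=> fact zD G0; have D0 : in_disc (0 : C) by rewrite /in_disc normr0.
have [psiC _ _] := fact.
have [_ sumz] := factorizing_cayley fact zD; have [_ sum0] := factorizing_cayley fact D0.
have zeta0 : zeta (0 : C) = -1 by rewrite /zeta add0r sub0r invrN invr1 mul1r.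
set G := cayley (psi j z); set k := (1 - `|z| ^+ 2)^-1.
pose b := ((1 - z)^-1)^*.
have HH : mxadj (G0 + mxadj G0) = G0 + mxadj G0 by rewrite mxadjD mxadjK addrC.
have key v : (G0 + mxadj G0) *m (- b *: v) + (G0 + mxadj G) *m v = 0.
  pose phi i := pick_form (cayley (psi i 0)) (cayley (psi i z)) k (- b *: v) v.
  have phi_le0 i : phi i <= 0 by apply: pick_cayley.
  have phi_sum : \sum_i - phi i == 0.
    by rewrite sumrN /phi pick_form_sum sum0 sumz zeta0 pick_form_zeta // oppr0.
  rewrite psumr_eq0 in phi_sum; last by move=> i _; rewrite oppr_ge0.
  have /allP/(_ j (mem_index_enum _))/implyP/(_ isT) := phi_sum.
  rewrite oppr_eq0 => /eqP phi0.
  (* With [v] fixed, the form is a quadratic function of [u], nonpositive everywhere and zero at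
     [- b *: v]. *)
  apply: (herm_quad_max HH _ phi0) => u.
  exact: pick_cayley (psiC j) zD.
have bE : b^* = (1 - zeta z) / 2 by rewrite /b conjCK zeta_inv.
clearbody b G G0.
have eqG : G0 + mxadj G = b *: (G0 + mxadj G0).
  apply: mulmx_ext => v; apply/eqP; rewrite -subr_eq0 -(key v) -scalemxAl.
  by rewrite -scalemxAr scaleNr addrC.
have -> : G = - mxadj G0 + b^* *: (G0 + mxadj G0).
  by rewrite -[X in _ + _ *: X]HH -mxadjZ -eqG mxadjD mxadjK addKr.
rewrite bE; move: (zeta z) (mxadj G0) => c G0'.
by apply/matrixP => i l; rewrite !mxE; move: (G0 i l) (G0' i l) => p q; field.
Qed.

End Rigidity.

(** * Comparing coefficients in [zeta], and contractivity of positive operators *)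

Section PencilConsequences.
Set Implicit Arguments.
Unset Strict Implicit.
Variable R : realType.
Local Notation C := R[i].
Variable d : nat.
Implicit Types (A B M N : 'M[C]_d) (u v w p : 'cV[C]_d).

(** A quadratic polynomial is determined by three values; [z = 0, 1/2, -1/2] give
    [zeta z = -1, -3, -1/3]. *)
Lemma zeta_poly_eq0 (M N K : 'M[C]_d) :
  (forall z : C, in_disc z -> M + zeta z *: N + zeta z ^+ 2 *: K = 0) ->
  [/\ M = 0, N = 0 & K = 0].
Proof.
move=> eq0; have half1 : `|2^-1 : C| < 1.
  by rewrite ger0_norm ?invr_ge0 // invf_lt1 ?ltr1n.
have E0 := eq0 0; have E1 := eq0 2^-1; have E2 := eq0 (- 2^-1).
rewrite /in_disc normr0 in E0; rewrite /in_disc in E1; rewrite /in_disc normrN in E2.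
have z0 : zeta (0 : C) = -1 by rewrite /zeta; field.
have z1 : zeta (2^-1 : C) = -3 by rewrite /zeta; field.
have z2 : zeta (- 2^-1 : C) = - 3^-1 by rewrite /zeta; field.
move: {E0 E1 E2}(E0 ltr01) (E1 half1) (E2 half1); rewrite z0 z1 z2 => E0 E1 E2.
have sol i j : [/\ M i j = 0, N i j = 0 & K i j = 0].
  have /matrixP/(_ i j) := E0; have /matrixP/(_ i j) := E1; have /matrixP/(_ i j) := E2.
  rewrite !mxE; set x := M i j; set y := N i j; set t := K i j => e2 e1 e0.
  have x0 : x = 0.
    (* Lagrange interpolation at [zeta = 0] from the three nodes. *)
    transitivity (((x + -3 * y + (-3) ^+ 2 * t) + 27 * (x + - 3^-1 * y + (- 3^-1) ^+ 2 * t)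
                  - 12 * (x + -1 * y + (-1) ^+ 2 * t)) / 16); first by field.
    by rewrite e0 e1 e2; field.
  have t0 : t = 0.
    transitivity (x + ((x + -3 * y + (-3) ^+ 2 * t) -
                   9 * (x + - 3^-1 * y + (- 3^-1) ^+ 2 * t)) / 8); first by field.
    by rewrite e1 e2 x0; field.
  split=> //; transitivity (x + t - (x + -1 * y + (-1) ^+ 2 * t)); first by ring.
  by rewrite e0 x0 t0; ring.
by split; apply/matrixP => i j; rewrite [RHS]mxE; case: (sol i j).
Qed.

Lemma pencil_inj A A' B B' :
  (forall z : C, in_disc z -> 'i *: A + zeta z *: B = 'i *: A' + zeta z *: B') ->
  A = A' /\ B = B'.
Proof.
move=> eqz; have [|/eqP + /eqP + _] := @zeta_poly_eq0 ('i *: (A - A')) (B - B') 0.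
  move=> z zD; rewrite scaler0 addr0 !scalerBr addrACA -opprD eqz //.
  exact: subrr.
by rewrite scaler_eq0 (negPf (neq0Ci _)) !subr_eq0 => /eqP-> /eqP->.
Qed.

(** The commutator of the two pencils is quadratic in [zeta]; its coefficients are, up to the
    factors [-1] and ['i], the three claimed relations. *)
Lemma pencil_commute A B A' B' :
  (forall z : C, in_disc z ->
    ('i *: A + zeta z *: B) *m ('i *: A' + zeta z *: B') =
    ('i *: A' + zeta z *: B') *m ('i *: A + zeta z *: B)) ->
  [/\ A *m A' = A' *m A, B *m B' = B' *m B & A *m B' + B *m A' = A' *m B + B' *m A].
Proof.
move=> eqz; have [|/eqP + /eqP + /eqP] := @zeta_poly_eq0 (- (A *m A' - A' *m A))
  ('i *: (A *m B' + B *m A' - (A' *m B + B' *m A))) (B *m B' - B' *m B).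
  move=> z /eqz /eqP; rewrite -subr_eq0 => /eqP <-.
  have ii : 'i * 'i = -1 :> C by rewrite -expr2 sqrCi.
  rewrite !mulmxDl !mulmxDr -!scalemxAl -!scalemxAr !scalerA ii.
  apply/matrixP => i j; rewrite !mxE.
  move: (\sum_j0 _) (\sum_j0 _) (\sum_j0 _) (\sum_j0 _) => a1 a2 a3 a4.
  move: (\sum_j0 _) (\sum_j0 _) (\sum_j0 _) (\sum_j0 _) => a5 a6 a7 a8.
  by ring.
rewrite oppr_eq0 scaler_eq0 (negPf (neq0Ci _)) !subr_eq0.
by move=> /eqP-> /eqP-> /eqP->.
Qed.

Lemma positive_contraction B : mxadj B = B -> positive_op B ->
  (forall v, dot v (B *m v) <= dot v v) -> contraction B.
Proof.
move=> BB Bpos Ble v; rewrite !vnorm2_dot; apply: le_trans (Ble v).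
have posB u : 0 <= dot u (B *m u) by rewrite /dot mulmxA.
(* [B - B^2 = B (1 - B) B + (1 - B) B (1 - B)] *)
rewrite -subr_ge0; set w := B *m v.
have -> : dot v w - dot w w =
    dot (v - w) (B *m (v - w)) + (dot w w - dot w (B *m w)).
  have vBw : dot v (B *m w) = dot w w by rewrite dot_adjr BB.
  by rewrite mulmxBr !(dotDl, dotDr, dotNl, dotNr) -/w vBw; ring.
by rewrite addr_ge0 // subr_ge0.
Qed.

End PencilConsequences.

(** * Construction and uniqueness of the pair *)

Theorem theorem4p9 (R : realType) (d n : nat) (psi : 'I_n -> R[i] -> 'M[R[i]]_d) :
  (2 <= n)%N ->
  factorizing psi ->
  exists A B : 'I_n -> 'M[R[i]]_d,
    [/\ good_pair psi A B,
        (forall A' B' : 'I_n -> 'M[R[i]]_d,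
           good_pair psi A' B' -> forall j, A' j = A j /\ B' j = B j) &
        (forall (j : 'I_n) (z : R[i]), in_disc z ->
           psi j z = ('i *: A j + zeta z *: B j + 1%:M)
                       *m invmx ('i *: A j + zeta z *: B j - 1%:M))].
Proof.
move=> _ fact; have [psiC _ _] := fact.
pose G0 j := cayley (psi j 0).
(* The imaginary part of [G0 j]; the next line takes minus its real part, as dictated by
   [cayley_rigid]. *)
pose A j := (- ('i / 2)) *: (G0 j - mxadj (G0 j)).
pose B j := - 2^-1 *: (G0 j + mxadj (G0 j)).
have D0 : in_disc (0 : R[i]) by rewrite /in_disc normr0.
have cayleyE j z : in_disc z -> cayley (psi j z) = 'i *: A j + zeta z *: B j.
  move=> zD; rewrite (cayley_rigid j fact zD) /A [in RHS]scalerA; congr (_ *: _ + _).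
  by rewrite mulrN mulrA -expr2 sqrCi mulN1r opprK.
have sadjA j : mxadj (A j) = A j.
  rewrite /A mxadjZ mxadjD mxadjN mxadjK -opprB scalerN -scaleNr; congr (_ *: _).
  by rewrite rmorphN rmorphM /= conjCi fmorphV rmorph_nat mulNr !opprK.
have sadjB j : mxadj (B j) = B j.
  rewrite /B mxadjZ mxadjD mxadjK addrC; congr (_ *: _).
  by rewrite rmorphN fmorphV rmorph_nat.
have posB j v : 0 <= dot v (B j *m v).
  (* With second vector 0 the form reduces to the Hermitian part of [G0 j], which is thus
     nonpositive. *)
  have := pick_cayley v 0 (psiC j) D0.
  rewrite /pick_form !mulmx0 !dot0r conjC0 mulr0 !addr0 => le0.
  by rewrite /B -scalemxAl dotZr mulr_le0 // oppr_le0 invr_ge0.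
clearbody A B.
have [sumA sumB] : \sum_j A j = 0 /\ \sum_j B j = 1%:M.
  apply: pencil_inj => z zD; rewrite scaler0 add0r scalemx1.
  have [_ <-] := factorizing_cayley fact zD.
  rewrite !scaler_sumr -big_split /=; apply: eq_bigr => j _.
  by rewrite cayleyE.
have contrB j : contraction (B j).
  have posBj : positive_op (B j) by move=> v; rewrite -mulmxA; apply: posB.
  apply: positive_contraction => // v; rewrite -subr_ge0.
  (* The [B k] sum to the identity, so the gap between it and [B j] is a sum of positive
     operators. *)
  have -> : dot v v = \sum_k dot v (B k *m v).
    by rewrite -dot_sumr -mulmx_suml sumB mul1mx.
  by rewrite (bigD1 j) //= addrAC subrr add0r sumr_ge0.
have comm j k : [/\ A j *m A k = A k *m A j, B j *m B k = B k *m B j &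
    A j *m B k + B j *m A k = A k *m B j + B k *m A j].
  apply: pencil_commute => z zD; rewrite -(cayleyE j z zD) -(cayleyE k z zD).
  by have [/(_ j k)] := factorizing_cayley fact zD.
exists A, B; split.
- split=> [j|j k|j k||j z zD]; [| | |by []|exact: cayleyE].
  + by split; [exact: sadjA|split=> // v; rewrite -mulmxA; apply: posB].
  + by have [] := comm j k.
  + by have [] := comm j k.
- move=> A' B' [_ _ _ _ cayleyE'] j; apply: pencil_inj => z zD.
  by rewrite -cayleyE' // cayleyE.
- move=> j z zD; rewrite -cayleyE //; apply: cayleyK.
  have [_ _ psi1] := psiC j.
  apply: unitmx_injective => v; rewrite mulmxBl mul1mx => /eqP.
  by rewrite subr_eq0 => /eqP/(psi1 z zD).
Qed.
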